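(* Let $\mathbb{K}$ be a field of characteristic zero, $n\ge 2$, and $R=\mathbb{K}[x_1,\ldots,x_n]$. Let $\psi$ be a tame automorphism of $R$, and let $g_1,\ldots,g_n\in R$ satisfy $\psi(x_1,\ldots,x_n)=(g_1,\ldots,g_n)$, i.e. $\psi(x_i)=g_i$ for $i=1,\ldots,n$. Let $F$ be an $l\times m$ matrix over $R$ with rank $\gamma$, where $1\le\gamma\le\min\{l,m\}$, and $d_\gamma(F)=g_1^{t_1}\cdots g_n^{t_n}$, where $t_1,\ldots,t_n$ are nonnegative integers. Then $F$ is equivalent over $R$ to its Smith normal form if and only if $\mathcal{J}_i(F)=R$ for $i=1,\ldots,\gamma$.
   Context: For an $l\times m$ matrix $F$ over $R$ of rank $\gamma\ge 1$ and $1\le i\le\gamma$, $d_i(F)$ denotes the greatest common divisor of all $i\times i$ minors of $F$ (determined up to a nonzero constant of $\mathbb{K}$), with $d_0(F)=1$. The $i\times i$ reduced minors of $F$ are the quotients of the $i\times i$ minors of $F$ by $d_i(F)$, and $\mathcal{J}_i(F)$ is the ideal of $R$ they generate. The Smith normal form of $F$ is the $l\times m$ matrix $S_F$ whose upper-left $\gamma\times\gamma$ block is $\mathrm{diag}(h_1,\ldots,h_\gamma)$ with $h_i=d_i(F)/d_{i-1}(F)$, all other entries being zero (it is known that $h_1\mid\cdots\mid h_\gamma$). Two $l\times m$ matrices $F,Q$ over $R$ are equivalent over $R$, written $F\sim_R Q$, if $UFV=Q$ for some $U\in\mathrm{GL}_l(R)$ and $V\in\mathrm{GL}_m(R)$,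 where $\mathrm{GL}_l(R)$ is the set of $l\times l$ matrices over $R$ whose determinant is a unit of $R$. A $\mathbb{K}$-algebra automorphism $\psi$ of $R$ is called tame if it is a finite composition of affine automorphisms and de Jonquières automorphisms. An affine automorphism is one of the form $\psi(x_i)=\sum_{j=1}^n a_{ij}x_j+c_i$ for $i=1,\ldots,n$, with $(a_{ij})\in\mathrm{GL}_n(\mathbb{K})$ and $c_1,\ldots,c_n\in\mathbb{K}$. A de Jonquières automorphism is one of the form $\psi(x_1)=a_1x_1+b_1$ and $\psi(x_j)=a_jx_j+q_j(x_1,\ldots,x_{j-1})$ for $j=2,\ldots,n$, with $a_1,\ldots,a_n\in\mathbb{K}\setminus\{0\}$, $b_1\in\mathbb{K}$ and $q_j\in\mathbb{K}[x_1,\ldots,x_{j-1}]$. *)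

(* Defs.v *)
From HB Require Import structures.
From mathcomp Require Import all_boot all_order all_algebra.
From mathcomp Require Export mpoly.

Set Implicit Arguments.
Unset Strict Implicit.
Unset Printing Implicit Defensive.

Import GRing.Theory.
Local Open Scope ring_scope.

Section RingDefs.
Variable R : idomainType.

Definition divides (a b : R) : Prop := exists q : R, b = q * a.

(* A gcd is only determined up to a unit, so "d is the gcd of S" is a
   relation between S and d rather than a function of S. *)
Definition is_gcd (S : R -> Prop) (d : R) : Prop :=
  (forall s, S s -> divides d s) /\
  (forall e, (forall s, S s -> divides e s) -> divides e d).

Definition ideal_gen (S : R -> Prop) (p : R) : Prop :=
  exists s : seq (R * R),
    (forall x, x \in s -> S x.2) /\ p = \sum_(x <- s) x.1 * x.2.

Definition whole_ring (I : R -> Prop) : Prop := forall p : R, I p.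

Variables l m : nat.
Implicit Types F Q S : 'M[R]_(l, m).

(* The increasing maps f and g enumerate the i rows and the i columns kept. *)
Definition is_minor F (i : nat) (p : R) : Prop :=
  exists (f : 'I_i -> 'I_l) (g : 'I_i -> 'I_m),
    [/\ {homo f : a b / (a < b)%N}, {homo g : a b / (a < b)%N} &
        p = \det (mxsub f g F)].

Definition mrank F : nat := \rank (map_mx (@tofrac R) F).

Definition is_minor_gcd F (i : nat) (d : R) : Prop := is_gcd (is_minor F i) d.

(* Every normalisation d of d_i(F) is allowed: two choices differ by a unit,
   which changes neither the ideal below nor the equivalence class of the
   Smith normal form. *)
Definition is_reduced_minor F (i : nat) (q : R) : Prop :=
  exists d : R, is_minor_gcd F i d /\ is_minor F i (q * d).

Definition reduced_minor_ideal F (i : nat) : R -> Prop :=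
  ideal_gen (is_reduced_minor F i).

(* h k is the invariant factor of index k + 1, i.e. d_(k+1)(F) / d_k(F). *)
Definition is_smith_form F S : Prop :=
  exists (d h : nat -> R),
    [/\ d 0%N = 1,
        forall i, (1 <= i <= mrank F)%N -> is_minor_gcd F i (d i),
        forall k, (k < mrank F)%N -> d k.+1 = h k * d k &
        S = \matrix_(i, j)
              (if ((i : nat) == j) && (i < mrank F)%N then h i else 0)].

Definition mx_equivalent F Q : Prop :=
  exists (U : 'M[R]_l) (V : 'M[R]_m),
    [/\ U \in unitmx, V \in unitmx & U *m F *m V = Q].

Definition equivalent_to_smith_form F : Prop :=
  exists S, is_smith_form F S /\ mx_equivalent F S.

End RingDefs.

Section TameDefs.
Variables (K : fieldType) (n : nat).
Implicit Types phi psi chi : {lrmorphism {mpoly K[n]} -> {mpoly K[n]}}.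

Definition is_affine_aut psi : Prop :=
  bijective psi /\
  exists (A : 'M[K]_n) (c : 'I_n -> K), A \in unitmx /\
    forall i, psi 'X_i = \sum_(j < n) A i j *: 'X_j + (c i)%:MP.

Definition in_vars_below (j : 'I_n) (q : {mpoly K[n]}) : Prop :=
  forall u : 'X_{1..n}, u \in msupp q -> forall k : 'I_n, (j <= k)%N -> u k = 0%N.

(* For the first variable (j = 0), in_vars_below says that q j is a constant. *)
Definition is_de_jonquieres_aut psi : Prop :=
  bijective psi /\
  exists (a : 'I_n -> K) (q : 'I_n -> {mpoly K[n]}),
    [/\ forall j, a j != 0, forall j, in_vars_below j (q j) &
        forall j, psi 'X_j = a j *: 'X_j + q j].

(* Composites are taken up to pointwise equality, so that tameness does not
   depend on the proofs packed in {lrmorphism _ -> _}. *)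
Inductive is_tame : {lrmorphism {mpoly K[n]} -> {mpoly K[n]}} -> Prop :=
| tame_affine psi : is_affine_aut psi -> is_tame psi
| tame_de_jonquieres psi : is_de_jonquieres_aut psi -> is_tame psi
| tame_comp phi psi chi :
    is_tame phi -> is_tame psi -> chi =1 phi \o psi -> is_tame chi.

End TameDefs.

(* Main.v *)
Require Import Defs.
From HB Require Import structures.
From mathcomp Require Import all_boot all_order all_fingroup all_algebra.
From mathcomp Require Import generic_quotient ring_quotient boolp zify ring.
From mathcomp Require classical_sets.

Set Implicit Arguments.
Unset Strict Implicit.
Unset Printing Implicit Defensive.

Import GRing.Theory.
Local Open Scope ring_scope.

(** The condition on the reduced minors of [F] says that, for each [i], the
    ideal of [R] generated by the [i]-minors of [F] is principal, generated by
    [d_i(F)].  Ideals of minors do not change when [F] is multiplied by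
    invertible matrices, and the leading [i]-minor of a Smith form is [d_i], so
    the condition is necessary ([smith_form_reduced_minors]).

    For the converse, each [d_i(F)] divides [d_gamma(F)], a monomial in the
    coordinates [g_1, .., g_n], hence is such a monomial up to a unit.  Since
    [psi] is invertible, [g_1, .., g_n] are as good coordinates as the variables
    themselves: all that is used of them is collected in [monomial_system].  It
    remains to diagonalise a matrix whose ideals of [i]-minors are generated by
    monomials [X^(D i)] ([monomial_smith_form]).  This is done by induction on
    the number of coordinates that divide [d_gamma(F)], then on the size.

    - There is an idempotent matrix with the kernel of [F]; idempotent matrices
      over a polynomial ring are similar to diagonal ones, so [F] may be taken
      square of size [gamma] ([square_reduction]).
    - Dividing by [d_1(F)], one may assume [d_1(F) = 1].  When a coordinate
      [x_j] dividing [d_gamma(F)] is set to zero, [F] becomes a matrix of the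
      same kind with fewer coordinates, so it can be diagonalised there.  Taking
      the [x_j] by increasing rank of these restrictions, the diagonalisations
      can be performed one after the other, each one fixing the restrictions
      already treated ([glue_restrictions]).
    - Afterwards the top left entry of [F] is [1] modulo each such [x_j].  The
      entries of the first column generate an ideal that also contains the
      determinant, a monomial in these [x_j]; so this ideal is the whole ring
      ([unimodular_first_column]).  A unimodular column is the first column of
      an invertible matrix, which splits off a diagonal entry [1] and leaves a
      matrix of smaller size.

    The two facts on projective modules used here are forms of the theorem of
    Quillen and Suslin ([mpoly_splitting]), proved by induction on the number of
    variables.  For an idempotent [E] over [A[x]], Quillen's patching argument
    ([quillen_patching]) reduces to finding, for every surjection [h] from [A]
    onto a field, a basis of the image of [E] after inverting some [s] of [A]
    with [h s != 0].  That is Horrocks's theorem ([horrocks]); it requires a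
    minor of [E] with invertible leading coefficient, obtained from a generic
    linear change of coordinates ([generic_unit_lead]), and the existence of
    contents in [A[x]] ([has_contents_poly]). *)
(** * Ideals generated by minors *)

Section Ideals.
Variable R : comNzRingType.

Definition is_ideal (J : R -> Prop) : Prop :=
  [/\ J 0, forall x y, J x -> J y -> J (x + y) & forall a x, J x -> J (a * x)].

Variables (J : R -> Prop) (idJ : is_ideal J).

Lemma ideal0 : J 0. Proof. by case: idJ. Qed.

Lemma idealD x y : J x -> J y -> J (x + y). Proof. by case: idJ => _ + _; apply. Qed.

Lemma idealMl a x : J x -> J (a * x). Proof. by case: idJ => _ _; apply. Qed.

Lemma idealMr a x : J x -> J (x * a). Proof. by rewrite mulrC; apply: idealMl. Qed.

Lemma idealN x : J x -> J (- x). Proof. by rewrite -mulN1r; apply: idealMl. Qed.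

Lemma idealB x y : J x -> J y -> J (x - y).
Proof. by move=> Jx Jy; apply: idealD => //; apply: idealN. Qed.

Lemma ideal_sum (I : Type) (r : seq I) (P : pred I) (F : I -> R) :
  (forall i, P i -> J (F i)) -> J (\sum_(i <- r | P i) F i).
Proof. by move=> JF; elim/big_ind: _ => //; [apply: ideal0 | apply: idealD]. Qed.

(** The rows and columns are chosen by arbitrary maps, not only increasing ones:
    this makes the condition visibly stable under products of matrices. *)
Definition minors_in l m (F : 'M[R]_(l, m)) i : Prop :=
  forall (f : 'I_i -> 'I_l) (g : 'I_i -> 'I_m), J (\det (mxsub f g F)).

(** One half of the Cauchy-Binet formula: once the product of sums is expanded
    over all maps [f], the terms with a given [f] add up to a multiple of
    [\det (rowsub f B)]. *)
Lemma ideal_det_mulmx i m (A : 'M[R]_(i, m)) (B : 'M[R]_(m, i)) :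
  (forall f : 'I_i -> 'I_m, J (\det (rowsub f B))) -> J (\det (A *m B)).
Proof.
move=> JB; rewrite /determinant.
under eq_bigr => s _.
  under eq_bigr => k _ do rewrite mxE.
  rewrite bigA_distr_bigA mulr_sumr.
  over.
rewrite exchange_big /=; apply: ideal_sum => f _.
suff -> : \sum_(s : 'S_i) (-1) ^+ s * \prod_(k < i) (A k (f k) * B (f k) (s k))
   = (\prod_(k < i) A k (f k)) * \det (rowsub f B) by apply: idealMl.
rewrite /determinant mulr_sumr; apply: eq_bigr => s _.
rewrite big_split /= mulrCA; congr (_ * (_ * _)).
by apply: eq_bigr => k _; rewrite mxE.
Qed.

Lemma minors_in_mul l m l' m' (A : 'M[R]_(l', l)) (F : 'M[R]_(l, m))
    (B : 'M[R]_(m, m')) i :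
  minors_in F i -> minors_in (A *m F *m B) i.
Proof.
move=> JF f g.
have -> : mxsub f g (A *m F *m B) = rowsub f A *m (F *m colsub g B).
  apply/matrixP=> a b; rewrite -mulmxA !mxE; apply: eq_bigr => k _.
  by rewrite !mxE; congr (_ * _); apply: eq_bigr => k' _; rewrite !mxE.
apply: ideal_det_mulmx => f'.
have -> : rowsub f' (F *m colsub g B) = (rowsub f' F) *m colsub g B.
  by apply/matrixP=> a b; rewrite !mxE; apply: eq_bigr => k _; rewrite !mxE.
rewrite -det_tr trmx_mul; apply: ideal_det_mulmx => g'.
suff -> : rowsub g' (rowsub f' F)^T = (mxsub f' g' F)^T by rewrite det_tr.
by apply/matrixP=> a b; rewrite !mxE.
Qed.

Lemma minors_in_tr l m (F : 'M[R]_(l, m)) i : minors_in F i -> minors_in F^T i.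
Proof. by move=> JF f g; rewrite -trmx_mxsub det_tr. Qed.

(** Laplace expansion along the first row. *)
Lemma minors_inS l m (F : 'M[R]_(l, m)) i : minors_in F i -> minors_in F i.+1.
Proof.
move=> JF f g; rewrite (expand_det_row _ ord0); apply: ideal_sum => k _.
apply: idealMl; rewrite /cofactor; apply: idealMl.
suff -> : row' ord0 (col' k (mxsub f g F)) =
  mxsub (f \o lift ord0) (g \o lift k) F by [].
by apply/matrixP=> a b; rewrite !mxE.
Qed.

Lemma det_mxsub_scale l m (F : 'M[R]_(l, m)) i (a : R) (f : 'I_i -> 'I_l) (g : 'I_i -> 'I_m) :
  \det (mxsub f g (a *: F)) = a ^+ i * \det (mxsub f g F).
Proof.
rewrite -detZ; congr (\det _); by apply/matrixP=> ? ?; rewrite !mxE.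
Qed.

Lemma inj_increasing i l (f : 'I_i -> 'I_l) : injective f ->
  exists (f' : 'I_i -> 'I_l) (s : 'S_i),
    {homo f' : a b / (a < b)%N} /\ f =1 f' \o s.
Proof.
move=> f_inj; pose A := [set f x | x in 'I_i].
have cA : #|A| = i by rewrite card_imset // card_ord.
have inA x : f x \in A by apply: imset_f.
have p_inj : injective (fun x => cast_ord cA (enum_rank_in (inA x) (f x))).
  move=> x y /cast_ord_inj /(congr1 enum_val).
  by rewrite !enum_rankK_in //; apply: f_inj.
exists (fun k => enum_val (cast_ord (esym cA) k)), (perm p_inj); split.
  move=> a b ab; rewrite /enum_val.
  set x0 := enum_default _; set y0 := enum_default _.
  rewrite (set_nth_default x0) -?cardE ?cA //.
  have : sorted ltn (map val (enum A)).
    apply: (@subseq_sorted _ _ ltn_trans _ (iota 0 l)).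
      rewrite -val_enum_ord; apply: map_subseq.
      by rewrite {1}/enum_mem -enumT; apply: filter_subseq.
    by apply: iota_ltn_sorted.
  move=> /(sorted_ltn_nth ltn_trans 0%N) /(_ a b).
  have lt_sz (k : 'I_i) : (k < size (enum A))%N by rewrite -cardE cA.
  by rewrite !inE size_map => /(_ (lt_sz a) (lt_sz b) ab); rewrite !(nth_map x0).
by move=> x /=; rewrite permE cast_ordK enum_rankK_in.
Qed.

(** A choice of rows that is not injective repeats a row, and an injective one
    is an increasing one followed by a permutation; the same holds for columns. *)
Lemma minors_in_increasing l m (F : 'M[R]_(l, m)) i :
  (forall (f : 'I_i -> 'I_l) (g : 'I_i -> 'I_m),
     {homo f : a b / (a < b)%N} -> {homo g : a b / (a < b)%N} ->
     J (\det (mxsub f g F))) -> minors_in F i.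
Proof.
move=> JF f g.
case: (boolP (injectiveb f)) => [/injectiveP f_inj|/injectivePn [x [y xy fxy]]]; last first.
  rewrite (determinant_alternate xy); first exact: ideal0.
  by move=> k; rewrite !mxE fxy.
case: (boolP (injectiveb g)) => [/injectiveP g_inj|/injectivePn [x [y xy gxy]]]; last first.
  rewrite -det_tr (determinant_alternate xy); first exact: ideal0.
  by move=> k; rewrite !mxE gxy.
have [f' [s [f'_inc fE]]] := inj_increasing f_inj.
have [g' [t [g'_inc gE]]] := inj_increasing g_inj.
have -> : mxsub f g F = row_perm s (col_perm t (mxsub f' g' F)).
  by apply/matrixP=> a b; rewrite !mxE fE gE.
rewrite row_permE col_permE !det_mulmx; apply: idealMl; apply: idealMr.
exact: JF.
Qed.

(** A minor of [diag(1, F)] that takes the first row twice is zero; one that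
    takes it once is expanded along it; one that does not take it is a minor of
    [F] bordered by zeros, to which Laplace expansion applies. *)
Lemma minors_in_diag1 l m (F : 'M[R]_(l, m)) i :
  minors_in (block_mx (1%:M : 'M_1) 0 0 F) i.+1 <-> minors_in F i.
Proof.
set D := block_mx _ _ _ _; split=> [JD f g|JF].
  pose h n (f0 : 'I_i -> 'I_n) : 'I_(1 + i) -> 'I_(1 + n) := fun a =>
    if split a is inr b then rshift 1 (f0 b) else lshift n ord0.
  have hl n (f0 : 'I_i -> 'I_n) a : h n f0 (lshift i a) = lshift n ord0.
    by rewrite /h (unsplitK (inl a)).
  have hr n (f0 : 'I_i -> 'I_n) a : h n f0 (rshift 1 a) = rshift 1 (f0 a).
    by rewrite /h (unsplitK (inr a)).
  have := JD (h _ f) (h _ g).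
  suff -> : mxsub (h _ f) (h _ g) D = block_mx (1%:M : 'M_1) 0 0 (mxsub f g F).
    have := det_ublock (1%:M : 'M[R]_1) 0 (mxsub f g F).
    by rewrite det1 mul1r => ->.
  rewrite -[LHS](@submxK _ 1 i 1 i); congr (@block_mx _ 1 i 1 i).
  - by apply/matrixP=> a b; do 3! rewrite mxE; rewrite !hl block_mxEul !ord1.
  - by apply/matrixP=> a b; do 3! rewrite mxE; rewrite hl hr block_mxEur !ord1 !mxE.
  - by apply/matrixP=> a b; do 3! rewrite mxE; rewrite hl hr block_mxEdl !ord1 !mxE.
  - by apply/matrixP=> a b; do 3! rewrite mxE; rewrite !hr block_mxEdr !mxE.
pose D0 : 'M[R]_(1 + l, 1 + m) := block_mx 0 0 0 F.
have JD0 : minors_in D0 i.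
  have -> : D0 = col_mx 0 1%:M *m F *m row_mx 0 1%:M.
    by rewrite mul_col_mx mul0mx mul1mx mul_mx_row mulmx1 mulmx0 /D0 block_mxEh col_mx0.
  exact: minors_in_mul.
have mx_DD0 j (f : 'I_j -> 'I_(1 + l)) g a b : f a != lshift l ord0 ->
    mxsub f g D a b = mxsub f g D0 a b.
  rewrite !mxE; case: (split_ordP (f a)) => k ->.
    by rewrite ord1 eqxx.
  by case: (split_ordP (g b)) => k' -> _; rewrite ?block_mxEdl ?block_mxEdr.
move=> f g.
case: (pickP (fun a => f a == lshift l ord0)) => [a /eqP fa|nof].
  case: (pickP (fun b => (b != a) && (f b == lshift l ord0))).
    move=> b /andP[ba /eqP fb].
    rewrite (determinant_alternate ba); first exact: ideal0.
    by move=> k; rewrite !mxE fa fb.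
  move=> nof; rewrite (expand_det_row _ a); apply: ideal_sum => k _.
  apply: idealMl; rewrite /cofactor; apply: idealMl.
  suff -> : row' a (col' k (mxsub f g D)) =
    mxsub (f \o lift a) (g \o lift k) D0 by apply: JD0.
  apply/matrixP=> x y.
  have <- := @mx_DD0 _ _ (f \o lift a) (g \o lift k) x y; first by rewrite !mxE.
  by have /= := nof (lift a x); rewrite eq_sym neq_lift /= => ->.
suff -> : mxsub f g D = mxsub f g D0 by apply: minors_inS.
by apply/matrixP=> x y; apply: mx_DD0; rewrite nof.
Qed.

End Ideals.

(** The ideal of [i]-minors of [F] is generated by [d].  Quantifying over the
    ideals that contain it avoids all explicit linear combinations of minors:
    divisibility statements come from the ideals of multiples, base change from
    inverse images of ideals. *)
Definition minor_ideal (R : comNzRingType) l m (F : 'M[R]_(l, m)) i (d : R) :=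
  forall J, is_ideal J -> (minors_in J F i <-> J d).

Section MinorIdeal.
Variable R : comNzRingType.

Lemma minor_ideal_mul l m l' m' (F : 'M[R]_(l, m)) (F' : 'M[R]_(l', m')) A B A' B' i d :
  F' = A *m F *m B -> F = A' *m F' *m B' -> minor_ideal F i d -> minor_ideal F' i d.
Proof.
move=> F'E FE Fd J idJ; rewrite -Fd //.
by split; [rewrite [F in _ -> minors_in _ F _]FE | rewrite F'E]; apply: minors_in_mul.
Qed.

Lemma minor_ideal_tr l m (F : 'M[R]_(l, m)) i d :
  minor_ideal F i d -> minor_ideal F^T i d.
Proof.
move=> Fd J idJ; rewrite -Fd //; split; last exact: minors_in_tr.
by rewrite -[F in _ -> minors_in _ F _]trmxK; apply: minors_in_tr.
Qed.

Lemma multiples_ideal (a : R) : is_ideal (fun x => exists q, x = q * a).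
Proof.
split; first by exists 0; rewrite mul0r.
  by move=> _ _ [p ->] [q ->]; exists (p + q); rewrite mulrDl.
by move=> b _ [p ->]; exists (b * p); rewrite mulrA.
Qed.

Lemma zero_ideal : is_ideal (fun x : R => x = 0).
Proof.
by split => // [x y -> ->|a x ->]; rewrite ?addr0 ?mulr0.
Qed.

Lemma minor_ideal_dvd l m (F : 'M[R]_(l, m)) i a b :
  minor_ideal F i a -> minor_ideal F i.+1 b -> exists q, b = q * a.
Proof.
move=> Fa Fb; have idJ := multiples_ideal a.
apply/(Fb _ idJ)/(minors_inS idJ)/(Fa _ idJ).
by exists 1; rewrite mul1r.
Qed.

Lemma minor_ideal_minor l m (F : 'M[R]_(l, m)) i a (f : 'I_i -> 'I_l) (g : 'I_i -> 'I_m) :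
  minor_ideal F i a -> exists q, \det (mxsub f g F) = q * a.
Proof.
move=> Fa; have idJ := multiples_ideal a.
have [_ Fdiv] := Fa _ idJ; apply: Fdiv.
by exists 1; rewrite mul1r.
Qed.

Lemma minor_ideal0 l m (F : 'M[R]_(l, m)) : minor_ideal F 0 1.
Proof.
move=> J idJ; split=> [JF|J1 f g]; last by rewrite -[\det _]mulr1; apply: idealMl.
have [f0 g0] : ('I_0 -> 'I_l) * ('I_0 -> 'I_m) by split; case.
by have := JF f0 g0; rewrite det_mx00.
Qed.

Lemma minor_ideal_diag1 l m (F : 'M[R]_(l, m)) i d :
  minor_ideal (block_mx (1%:M : 'M_1) 0 0 F) i.+1 d -> minor_ideal F i d.
Proof. by move=> Fd J idJ; rewrite -minors_in_diag1 // Fd. Qed.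

Lemma minor_idealU l m (F : 'M[R]_(l, m)) i d c c' :
  c * c' = 1 -> minor_ideal F i (c * d) -> minor_ideal F i d.
Proof.
move=> cc' Fd J idJ; rewrite Fd //; split; last exact: idealMl.
by move/(idealMl idJ c'); rewrite mulrA [c' * c]mulrC cc' mul1r.
Qed.

Lemma det_sub_sq r (F : 'M[R]_r) (f g : 'I_r -> 'I_r) :
  exists q, \det (mxsub f g F) = q * \det F.
Proof.
have -> : mxsub f g F = rowsub f 1%:M *m F *m colsub g 1%:M.
  apply/matrixP=> a b; rewrite -mulmxA mul_rowsub_mx mul1mx mulmx_colsub mulmx1.
  by rewrite !mxE.
by rewrite !det_mulmx mulrAC; exists (\det (rowsub f (1%:M : 'M[R]_r)) * \det (colsub g (1%:M : 'M[R]_r))).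
Qed.

End MinorIdeal.

Lemma minors_in_map (R R' : comNzRingType) (h : {rmorphism R -> R'}) J' l m
    (F : 'M[R]_(l, m)) i :
  minors_in J' (map_mx h F) i <-> minors_in (fun x => J' (h x)) F i.
Proof.
have E f g : \det (mxsub f g (map_mx h F)) = h (\det (mxsub f g F)) :> R'.
  rewrite -det_map_mx; congr (\det _); by apply/matrixP=> a b; rewrite !mxE.
by split=> JF f g; [rewrite -E | rewrite E]; apply: JF.
Qed.

Lemma ideal_preim (R R' : comNzRingType) (h : {rmorphism R -> R'}) (J' : R' -> Prop) :
  is_ideal J' -> is_ideal (fun x => J' (h x)).
Proof.
move=> idJ; split; first by rewrite rmorph0; apply: ideal0.
  by move=> x y; rewrite rmorphD; apply: idealD.
by move=> a x; rewrite rmorphM; apply: idealMl.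
Qed.

Lemma minor_ideal_map (R R' : comNzRingType) (h : {rmorphism R -> R'}) l m
    (F : 'M[R]_(l, m)) i d :
  minor_ideal F i d -> minor_ideal (map_mx h F) i (h d).
Proof.
move=> Fd J' idJ'; rewrite minors_in_map Fd //; exact: ideal_preim.
Qed.

(** An ideal [J] is tested on [F] by testing [a ^+ i * J] on [a *: F]. *)
Lemma minor_idealZ (R : idomainType) l m (F : 'M[R]_(l, m)) i (a d : R) :
  a != 0 -> minor_ideal (a *: F) i (a ^+ i * d) -> minor_ideal F i d.
Proof.
move=> a0 Fd J idJ.
have ai0 : a ^+ i != 0 by rewrite expf_neq0.
have idaJ : is_ideal (fun y => exists2 x, J x & y = a ^+ i * x).
  split; first by exists 0; [apply: ideal0 | rewrite mulr0].
    by move=> _ _ [x Jx ->] [y Jy ->]; exists (x + y); [apply: idealD | rewrite mulrDr].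
  by move=> b _ [x Jx ->]; exists (b * x); [apply: idealMl | rewrite mulrCA].
have [H1 H2] := Fd _ idaJ; split=> [JF|Jd f g].
  have [|x Jx /(mulfI ai0) ->] // := H1 _.
  by move=> f g; exists (\det (mxsub f g F)) => //; rewrite det_mxsub_scale.
have [|x Jx] := H2 _ f g; first by exists d.
by rewrite det_mxsub_scale => /(mulfI ai0) ->.
Qed.

(** * Rank over the fraction field *)

Section FractionRank.
Variable R : idomainType.
Notation frac := (map_mx (@tofrac R)).

Lemma map_tofrac_inj l m : injective (fun F : 'M[R]_(l, m) => frac F).
Proof.
move=> A B /matrixP AB; apply/matrixP=> i j; have := AB i j; rewrite !mxE.
by move/eqP; rewrite tofrac_eq => /eqP.
Qed.

Lemma scalemx_inj l m (a : R) : a != 0 -> injective (fun F : 'M[R]_(l, m) => a *: F).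
Proof.
move=> a0 X Y /matrixP XY; apply/matrixP=> i j; apply: (mulfI a0).
by have := XY i j; rewrite !mxE.
Qed.

Lemma mrank_cancel r m (T : 'M[R]_(r, m)) (X : 'M[R]_(m, r)) :
  mrank T = r -> T *m X *m T = T -> T *m X = 1%:M.
Proof.
move=> rT TXT; apply: map_tofrac_inj => /=; rewrite map_mxM map_mx1.
have T_free : row_free (frac T) by rewrite /row_free -[\rank _]/(mrank T) rT.
by apply: (row_free_inj T_free); rewrite /= -!map_mxM TXT mul1mx.
Qed.

Lemma mrank_mul_le_r l m n (A : 'M[R]_(l, m)) (B : 'M[R]_(m, n)) :
  (mrank (A *m B) <= mrank B)%N.
Proof. by rewrite /mrank map_mxM mxrankM_maxr. Qed.

Lemma mrank_mul_le_l l m n (A : 'M[R]_(l, m)) (B : 'M[R]_(m, n)) :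
  (mrank (A *m B) <= mrank A)%N.
Proof. by rewrite /mrank map_mxM mxrankM_maxl. Qed.

Lemma mrank_unit l m (M : 'M[R]_l) (A : 'M[R]_(l, m)) :
  M \in unitmx -> mrank (M *m A) = mrank A.
Proof.
move=> uM; apply/eqP; rewrite eqn_leq mrank_mul_le_r /=.
by rewrite -{1}[A](mulKmx uM) mrank_mul_le_r.
Qed.

Lemma mrank_block_triangular c d (g : 'M[R]_1) (b : 'M[R]_(1, d)) (a : 'M[R]_(c, d)) :
  g != 0 -> mrank (block_mx g b 0 a) = (mrank a).+1.
Proof.
move=> g0; rewrite /mrank map_block_mx raddf0.
set g' := map_mx _ g; set b' := map_mx _ b; set a' := map_mx _ a.
have ug : g' \in unitmx.
  rewrite unitmxE unitfE det_mx11 mxE tofrac_eq0.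
  apply: contra_neq g0 => g00; apply/matrixP=> i j.
  by rewrite !ord1 g00 mxE.
have -> : block_mx g' b' 0 a' = block_mx g' 0 0 a' *m block_mx 1%:M (invmx g' *m b') 0 1%:M.
  by rewrite mulmx_block !mulmx0 !mul0mx !mulmx1 !addr0 add0r mulKVmx // add0r.
rewrite mxrankMfree; last first.
  by rewrite row_free_unit unitmxE det_ublock !det1 mulr1 unitr1.
by rewrite rank_diag_block_mx mxrank_unit // add1n.
Qed.

End FractionRank.

Lemma minor_mrank (R : idomainType) l m (F : 'M[R]_(l, m)) i (f : 'I_i -> 'I_l) (g : 'I_i -> 'I_m) :
  \det (mxsub f g F) != 0 -> (i <= mrank F)%N.
Proof.
move=> d0; have -> : i = mrank (mxsub f g F).
  apply/esym/mxrank_unit; rewrite unitmxE unitfE det_map_mx tofrac_eq0 //.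
have -> : mxsub f g F = rowsub f 1%:M *m (F *m colsub g 1%:M).
  by apply/matrixP=> a b; rewrite mulmx_colsub mulmx1 mul_rowsub_mx mul1mx !mxE.
exact: leq_trans (mrank_mul_le_r _ _) (mrank_mul_le_l _ _).
Qed.

Lemma mrank_minor (R : idomainType) l m (F : 'M[R]_(l, m)) :
  exists (f : 'I_(mrank F) -> 'I_l) (g : 'I_(mrank F) -> 'I_m), \det (mxsub f g F) != 0.
Proof.
set F' := map_mx (@tofrac R) F; pose B := rowsub (maxrankfun F') F'.
have B_full : row_full B^T by rewrite /row_full mxrank_tr; apply: maxrowsub_free.
exists (maxrankfun F'), (fullrankfun B_full).
have := fullrowsub_unit B_full; rewrite -unitmx_tr unitmxE unitfE.
suff -> : (rowsub (fullrankfun B_full) B^T)^T =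
    map_mx (@tofrac R) (mxsub (maxrankfun F') (fullrankfun B_full) F).
  by rewrite det_map_mx tofrac_eq0.
by apply/matrixP=> i j; rewrite !mxE.
Qed.

Lemma mrank_map (R R' : idomainType) (h : {rmorphism R -> R'}) l m (F : 'M[R]_(l, m)) :
  injective h -> mrank (map_mx h F) = mrank F.
Proof.
move=> h_inj; have h0 x : (h x == 0) = (x == 0) by rewrite -(inj_eq h_inj) rmorph0.
apply/eqP; rewrite eqn_leq; apply/andP; split.
  have [f [g]] := mrank_minor (map_mx h F).
  by rewrite -map_mxsub det_map_mx h0; apply: minor_mrank.
have [f [g fgF]] := mrank_minor F; apply: (@minor_mrank _ _ _ _ _ f g).
by rewrite -map_mxsub det_map_mx h0.
Qed.

Section MinorRank.
Variable R : idomainType.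

Lemma minor_ideal_mrank l m (F : 'M[R]_(l, m)) r d :
  d != 0 -> minor_ideal F r d -> minor_ideal F r.+1 0 -> mrank F = r.
Proof.
move=> d0 Fd F0; apply/eqP; rewrite eqn_leq; apply/andP; split; last first.
  rewrite leqNgt; apply/negP => lt_r; case/eqP: d0.
  apply/(Fd _ (zero_ideal R)) => f g; apply/eqP; apply: contraTT lt_r.
  by rewrite -leqNgt; apply: minor_mrank.
rewrite leqNgt; apply/negP => lt_r.
have minors0 i : minors_in (fun x : R => x = 0) F (i + r.+1).
  elim: i => [|i IHi]; first by apply/(F0 _ (zero_ideal R)).
  exact: (minors_inS (zero_ideal R)).
have [f [g /eqP]] := mrank_minor F; apply.
by move: f g; rewrite -(subnK lt_r); apply: minors0.
Qed.

Lemma mrank_tr l m (F : 'M[R]_(l, m)) : mrank F^T = mrank F.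
Proof. by rewrite /mrank -map_trmx mxrank_tr. Qed.

End MinorRank.

Section Equivalence.
Variable R : idomainType.

Lemma unit_conjK l m (F : 'M[R]_(l, m)) U V :
  U \in unitmx -> V \in unitmx -> F = invmx U *m (U *m F *m V) *m invmx V.
Proof. by move=> uU uV; rewrite !mulmxA mulVmx // mul1mx mulmxK. Qed.

Lemma mrank_mul_unit l m (F : 'M[R]_(l, m)) U V :
  U \in unitmx -> V \in unitmx -> mrank (U *m F *m V) = mrank F.
Proof.
move=> uU uV; rewrite -mulmxA mrank_unit // -mrank_tr trmx_mul.
by rewrite mrank_unit ?unitmx_tr // mrank_tr.
Qed.

Lemma minor_ideal_equiv l m (F : 'M[R]_(l, m)) U V i d :
  U \in unitmx -> V \in unitmx -> minor_ideal F i d -> minor_ideal (U *m F *m V) i d.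
Proof.
move=> uU uV; apply: minor_ideal_mul; [by [] | exact: unit_conjK].
Qed.

End Equivalence.

(** * Contents and Gauss's lemma *)

Section Contents.
Variable R : idomainType.

(** No gcd is mentioned, so that primitivity makes sense, and Gauss's lemma
    holds, over every domain.  The existence of contents below is what is needed
    of unique factorisation. *)
Definition primitive_seq (c : seq R) :=
  forall a b : R, (forall x, x \in c -> divides b (a * x)) -> divides b a.

Definition has_contents :=
  forall v : seq R, has (predC1 0) v ->
    exists g c, v = map ( *%R g) c /\ primitive_seq c.

Lemma divides0 (a : R) : divides a 0. Proof. by exists 0; rewrite mul0r. Qed.

Lemma dividesMl (a b c : R) : divides a b -> divides a (c * b).
Proof. by move=> [q ->]; exists (c * q); rewrite mulrA. Qed.

Lemma dividesMr (a b c : R) : divides a b -> divides a (b * c).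
Proof. by rewrite mulrC; apply: dividesMl. Qed.

Lemma dividesD (a b c : R) : divides a b -> divides a c -> divides a (b + c).
Proof. by move=> [q ->] [r ->]; exists (q + r); rewrite mulrDl. Qed.

Lemma dividesN (a b : R) : divides a b -> divides a (- b).
Proof. by move=> [q ->]; exists (- q); rewrite mulNr. Qed.

Lemma divides_seq (g : R) (v : seq R) :
  (forall x, x \in v -> divides g x) -> exists c, v = map ( *%R g) c.
Proof.
elim: v => [|x v IHv] gv; first by exists [::].
have [q xE] := gv x (mem_head _ _).
have [|c ->] := IHv; first by move=> y yv; apply: gv; rewrite inE yv orbT.
by exists (q :: c); rewrite /= xE mulrC.
Qed.

End Contents.

Section Gauss.
Variable R : idomainType.
Implicit Types (p q : {poly R}) (a b : R).

Lemma divides_coef b q : divides b%:P q <-> forall i, divides b q`_i.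
Proof.
split=> [[t ->] i|]; first by rewrite coefMC; exists t`_i.
elim/poly_ind: q => [_|q c IHq bq]; first exact: divides0.
apply: dividesD.
  apply: dividesMr; apply: IHq => i.
  by have := bq i.+1; rewrite coefD coefMX coefC addr0.
have [t] := bq 0%N; rewrite coefD coefMX coefC add0r => ->.
by exists t%:P; rewrite polyCM.
Qed.

Lemma poly_lead_split p :
  p = take_poly (size p).-1 p + lead_coef p *: 'X^((size p).-1).
Proof.
apply/polyP=> i; rewrite coefD coef_take_poly coefZ coefXn.
case: ltngtP => [_|lt_i|->]; rewrite ?mulr0 ?addr0 ?mulr1 ?add0r //.
by rewrite nth_default // -ltnS (leq_ltn_trans (leqSpred _)).
Qed.

(** A weak form of the Dedekind-Mertens lemma, which does the work of prime
    elements in the usual proof of Gauss's lemma.  If [b] divides [a * p * q],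
    then it divides [a * lead_coef p * p * q'], where [q'] is [q] without its
    leading term, because it divides [a * lead_coef p * lead_coef q].  By
    induction on the sizes, products of enough coefficients of [p] that involve
    the leading one do what is claimed; products of the others are then treated
    with [p] deprived of its leading term. *)
Lemma divides_prod_coef p q :
  exists k, forall a b, divides b%:P (a *: (p * q)) ->
  forall I : seq nat, (k <= size I)%N ->
    divides b%:P ((a * \prod_(i <- I) p`_i) *: q).
Proof.
have [N] := ubnP (size p + size q); elim: N p q => // N IH p q.
have [->|p0] := eqVneq p 0.
  exists 1%N => a b _ [|i I] // _; rewrite big_cons coef0 mul0r mulr0 scale0r.
  exact: divides0.
have [->|q0] := eqVneq q 0.
  by exists 0%N => a b _ I _; rewrite scaler0; apply: divides0.
rewrite ltnS => le_N.
set n := (size p).-1; set m := (size q).-1.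
pose pm := take_poly n p; pose qm := take_poly m q.
have pE : p = pm + lead_coef p *: 'X^n by apply: poly_lead_split.
have qE : q = qm + lead_coef q *: 'X^m by apply: poly_lead_split.
have sp : (size pm < size p)%N.
  by rewrite (leq_ltn_trans (size_take_poly _ _)) // prednK // size_poly_gt0.
have sq : (size qm < size q)%N.
  by rewrite (leq_ltn_trans (size_take_poly _ _)) // prednK // size_poly_gt0.
have [k1 H1] := IH p qm (leq_trans (eq_leq (esym (addnS _ _))) (leq_trans (leq_add (leqnn _) sq) le_N)).
have [k2 H2] := IH pm q (leq_trans (eq_leq (esym (addSn _ _))) (leq_trans (leq_add sp (leqnn _)) le_N)).
have P1 a b : divides b%:P (a *: (p * q)) -> forall I, (k1 <= size I)%N ->
    divides b%:P ((a * lead_coef p * \prod_(i <- I) p`_i) *: q).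
  move=> bpq I sI.
  have blc : divides b (a * lead_coef p * lead_coef q).
    rewrite -mulrA -lead_coefM /lead_coef -coefZ.
    by move/divides_coef: bpq; apply.
  have bX (r : {poly R}) c : divides b%:P ((a * lead_coef p * c * lead_coef q) *: r).
    rewrite -mul_polyC; apply: dividesMr; apply/divides_coef => i.
    rewrite coefC; case: eqP => _; last exact: divides0.
    by rewrite mulrAC; apply: dividesMr.
  rewrite qE scalerDr; apply: dividesD; last by rewrite scalerA; apply: bX.
  apply: H1 => //; have -> : (a * lead_coef p) *: (p * qm) =
      lead_coef p *: (a *: (p * q)) - (a * lead_coef p * lead_coef q) *: (p * 'X^m).
    have -> : p * q = p * qm + lead_coef q *: (p * 'X^m).
      by rewrite scalerAr -mulrDr -qE.
    by rewrite !scalerDr !scalerA [lead_coef p * a]mulrC addrK.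
  apply: dividesD; first by rewrite -mul_polyC; apply: dividesMl.
  by apply: dividesN; have := bX (p * 'X^m) 1; rewrite mulr1.
exists (k1 + k2).+1 => a b bpq I sI.
have [nI|nI] := boolP (n \in I).
  rewrite (perm_big _ (perm_to_rem nI)) big_cons mulrA; apply: P1 => //.
  rewrite size_rem // -ltnS prednK ?(leq_trans _ sI) // ltnS ?leq_addr //.
rewrite -(cat_take_drop k1 I) big_cat /= mulrA.
have sI1 : (k1 <= size (take k1 I))%N.
  by rewrite size_take_min leq_min leqnn (leq_trans _ sI) // -addnS leq_addr.
have -> : \prod_(i <- drop k1 I) p`_i = \prod_(i <- drop k1 I) pm`_i.
  apply: eq_big_seq => i /mem_drop iI; rewrite coef_take_poly.
  case: ltnP => // le_ni; rewrite nth_default //.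
  have : i != n by apply: contraNneq nI => <-.
  by rewrite neq_ltn ltnNge le_ni /= /n prednK // size_poly_gt0.
apply: H2; last first.
  by rewrite size_drop leq_subRL; [exact: ltnW | rewrite (leq_trans _ sI) // -addnS leq_addr].
set c := a * _.
have -> : c *: (pm * q) = c *: (p * q) - (c * lead_coef p) *: q * 'X^n.
  have -> : p * q = pm * q + lead_coef p *: (q * 'X^n).
    by rewrite [q * _]mulrC scalerAl -mulrDl -pE.
  by rewrite scalerDr -scalerAl scalerA addrK.
apply: dividesD.
  by rewrite /c mulrC -scalerA -mul_polyC; apply: dividesMl.
apply: dividesN; apply: dividesMr; rewrite /c mulrAC; exact: P1.
Qed.

(** By primitivity, the coefficients of [p] that multiply [q] in
    [divides_prod_coef] can be removed one at a time. *)
Lemma gauss_poly p q b : primitive_seq p -> divides b%:P (p * q) -> divides b%:P q.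
Proof.
move=> p_prim bpq; have [k Hk] := divides_prod_coef p q.
suff H j I : (k - j <= size I)%N -> divides b%:P ((\prod_(i <- I) p`_i) *: q).
  by have := H k [::]; rewrite subnn leqn0 big_nil scale1r; apply.
elim: j I => [|j IHj] I sI.
  by have := Hk 1 b; rewrite scale1r subn0 in sI * => /(_ bpq I sI); rewrite mul1r.
apply/divides_coef => i; apply: p_prim => _ /(nthP 0) [n _ <-].
have := IHj (n :: I); rewrite /= leq_subLR addnS -addSn -leq_subLR.
move=> /(_ sI)/divides_coef/(_ i); rewrite !coefZ big_cons.
by rewrite -mulrA mulrC.
Qed.

Lemma primitive_neq0 p : primitive_seq p -> p != 0.
Proof.
move=> p_prim; apply/eqP=> p0; have [] := p_prim 1 0.
  by move=> x; rewrite p0 polyseq0.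
by move=> q /eqP; rewrite mulr0 oner_eq0.
Qed.

(** Pseudo-divisibility is divisibility over the fraction field; Gauss's lemma
    clears the denominators. *)
Lemma primitive_dvdp p q : primitive_seq p -> p %| q -> divides p q.
Proof.
move=> p_prim /Pdiv.Idomain.dvdpP [[c t] /= c0 cE].
have [|t' tE] := gauss_poly (q := t) (b := c) p_prim.
  by rewrite mulrC -cE -mul_polyC; apply: dividesMr; exists 1; rewrite mul1r.
have cP0 : c%:P != 0 by rewrite polyC_eq0.
exists t'; apply: (mulfI cP0); rewrite mul_polyC cE tE.
by rewrite mulrCA mulrA.
Qed.

Hypothesis R_cont : has_contents R.

Lemma poly_content p : p != 0 -> exists a g, [/\ a != 0, primitive_seq (polyseq g) & p = a *: g].
Proof.
move=> p0; have [|a [c [pE c_prim]]] := @R_cont p.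
  apply/hasP; exists (lead_coef p); last by rewrite /= lead_coef_eq0.
  by rewrite lead_coefE mem_nth // prednK // size_poly_gt0.
have pE' : p = a *: Poly c.
  apply/polyP=> i; rewrite coefZ coef_Poly pE.
  have [lt_i|le_i] := ltnP i (size c); first by rewrite (nth_map 0).
  by rewrite !nth_default ?size_map ?mulr0.
exists a, (Poly c); split=> //.
  by apply: contra_neq p0 => a0; rewrite pE' a0 scale0r.
move=> x b bx; apply: c_prim => _ /(nthP 0) [i _ <-]; rewrite -coef_Poly.
have [lt_i|le_i] := ltnP i (size (Poly c)); first by apply: bx; rewrite mem_nth.
by rewrite nth_default // mulr0; apply: divides0.
Qed.

Lemma dvdp_mul_big_gcdp (d f : {poly R}) (v : seq {poly R}) :
  (forall x, x \in v -> d %| f * x) -> d %| f * foldr (@Pdiv.Idomain.gcdp R) 0 v.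
Proof.
elim: v => [_|x v IHv dv] /=; first by rewrite mulr0 dvdp0.
rewrite (eqp_dvdr _ (mulp_gcdr _ _ _)) dvdp_gcd dv ?mem_head //=.
by apply: IHv => y yv; apply: dv; rewrite inE yv orbT.
Qed.

Lemma dvdp_big_gcdp (v : seq {poly R}) x : x \in v ->
  foldr (@Pdiv.Idomain.gcdp R) 0 v %| x.
Proof.
elim: v => //= y v IHv; rewrite inE => /predU1P[->|xv]; first exact: dvdp_gcdl.
exact: dvdp_trans (dvdp_gcdr _ _) (IHv xv).
Qed.

(** The content of [v] is the primitive part of its gcd over the fraction field,
    times the content of all the coefficients of the quotients. *)
Lemma has_contents_poly : has_contents {poly R}.
Proof.
move=> v v0; set G := foldr (@Pdiv.Idomain.gcdp R) 0 v.
have G0 : G != 0.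
  have /hasP [x xv /= x0] := v0; apply: contra_neq x0 => G0.
  by have := dvdp_big_gcdp xv; rewrite -/G G0 dvd0p => /eqP.
have [a [g [a0 g_prim GE]]] := poly_content G0.
have Gg : G %= g by rewrite GE eqp_scale.
have [x xv|c vE] := @divides_seq _ g v.
  apply: primitive_dvdp => //; rewrite -(eqp_dvdl _ Gg); exact: dvdp_big_gcdp.
have g0 := primitive_neq0 g_prim.
have dvd_c (b f : {poly R}) : (forall x, x \in c -> b %| f * x) -> b %| f.
  move=> bc; rewrite -(dvdp_mul2r _ _ g0).
  rewrite -(eqp_dvdr _ (eqp_mull f Gg)); apply: dvdp_mul_big_gcdp => x.
  rewrite vE => /mapP [y yc ->].
  by rewrite [g * y]mulrC mulrA dvdp_mul // bc.
have c0 : has (predC1 0) c.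
  have /hasP [x] := v0; rewrite vE => /mapP[y yc ->] /= gy0.
  by apply/hasP; exists y => //=; apply: contra_neq gy0 => ->; rewrite mulr0.
have [|d [w [wE w_prim]]] := @R_cont (flatten (map (@polyseq R) c)).
  have /hasP [x xc x0] := c0; apply/hasP; exists (lead_coef x).
    apply/flattenP; exists (polyseq x); first exact: map_f.
    by rewrite lead_coefE mem_nth // prednK // size_poly_gt0.
  by rewrite /= lead_coef_eq0.
have dc x : x \in c -> divides d%:P x.
  move=> xc; apply/divides_coef => i.
  have [lt_i|le_i] := ltnP i (size x); last by rewrite nth_default //; apply: divides0.
  have : x`_i \in flatten (map (@polyseq R) c).
    by apply/flattenP; exists (polyseq x); [apply: map_f | apply: mem_nth].
  by rewrite wE => /mapP [y _ ->]; exists y; rewrite mulrC.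
have [e cE] := divides_seq dc.
have e0 : has (predC1 0) e.
  have /hasP [x] := c0; rewrite cE => /mapP[y yc ->] /= gy0.
  by apply/hasP; exists y => //=; apply: contra_neq gy0 => ->; rewrite mulr0.
have d0 : d != 0.
  have /hasP [x] := c0; rewrite cE => /mapP[y yc ->] /=.
  by apply: contra_neq => ->; rewrite mul0r.
(* [c] has content [d], so its quotient [e] is primitive over [R]. *)
have e_prim (x b : R) : (forall y, y \in e -> divides b%:P (x *: y)) -> divides b x.
  move=> be; apply: w_prim => y yw.
  have : d * y \in flatten (map (@polyseq R) c) by rewrite wE map_f.
  move=> /flattenP [_ /mapP [z zc ->]] /(nthP 0) [i _].
  move: zc; rewrite cE => /mapP [t te ->]; rewrite coefCM => /(mulfI d0) <-.
  by rewrite -coefZ; have /divides_coef := be _ te; apply.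
exists (g * d%:P), e; split.
  by rewrite vE cE -map_comp; apply: eq_map => x /=; rewrite mulrA.
move=> f b bf.
have [->|f0] := eqVneq f 0; first exact: divides0.
have [b0|b0] := eqVneq b 0.
  have /hasP [x xe /= x0] := e0; have [q /eqP] := bf _ xe.
  by rewrite b0 mulr0 mulf_eq0 (negPf f0) (negPf x0).
have [bc [bp [bc0 bp_prim bE]]] := poly_content b0.
(* Divisibility by a primitive polynomial is tested over the fraction field,
   where [c] generates the unit ideal. *)
have [f1 f1E] : divides bp f.
  apply: primitive_dvdp => //; have bbp : b %= bp by rewrite bE eqp_scale.
  rewrite -(eqp_dvdl _ bbp); apply: dvd_c => x; rewrite cE => /mapP [y ye ->].
  have [q] := bf _ ye; rewrite mulrCA => ->.
  by rewrite mulrA dvdp_mulIr.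
have f10 : f1 != 0 by apply: contra_neq f0; rewrite f1E => ->; rewrite mul0r.
have [fc [fp [fc0 fp_prim f1E']]] := poly_content f10.
have [t tE] : divides bc fc.
  apply: e_prim => x xe; apply: (gauss_poly fp_prim).
  have [q qE] := bf _ xe; exists q.
  apply: (mulfI (primitive_neq0 bp_prim)).
  rewrite [RHS]mulrCA [bp * bc%:P]mulrC mul_polyC -bE -qE f1E f1E' -!mul_polyC.
  by rewrite -!mulrA [LHS]mulrCA [RHS]mulrCA; congr (_ * _); rewrite mulrCA.
exists (t *: fp); rewrite f1E f1E' tE bE -!mul_polyC polyCM.
by rewrite -!mulrA; congr (_ * _); rewrite mulrCA.
Qed.

End Gauss.

Lemma has_contents_field (K : fieldType) : has_contents K.
Proof.
move=> v /hasP [x xv /= x0]; exists 1, v; split.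
  by rewrite (eq_map (g := id)) ?map_id // => y; rewrite mul1r.
move=> a b /(_ x xv) [q E]; exists (q / x); apply: (mulIf x0).
by rewrite E mulrAC divfK.
Qed.

Lemma has_contents_iso (R R' : idomainType) (f : {rmorphism R -> R'}) (g : {rmorphism R' -> R}) :
  cancel f g -> cancel g f -> has_contents R -> has_contents R'.
Proof.
move=> fK gK Rc v v0; have [|a [c [vE c_prim]]] := Rc (map g v).
  have /hasP [x xv /= x0] := v0; apply/hasP; exists (g x); first exact: map_f.
  by rewrite /= -(rmorph0 g) (can_eq gK).
exists (f a), (map f c); split.
  rewrite -[v](mapK gK) vE -!map_comp; apply: eq_map => x /=.
  by rewrite rmorphM.
move=> x b bx; have [|q qE] := c_prim (g x) (g b).
  move=> y yc; have [|q qE] := bx (f y); first exact: map_f.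
  by exists (g q); rewrite -[y]fK -!rmorphM qE.
by exists (f q); rewrite -[x]gK qE rmorphM gK.
Qed.

(** * Echelon forms over a univariate polynomial ring *)

Section Echelon.
Variable k : fieldType.
Notation R := {poly k}.

(** Euclid's algorithm: as long as some remainder modulo the top entry is not
    zero, it is moved to the top. *)
Lemma clear_column_ind c N (v : 'cV[R]_(1 + c)) :
  v ord0 0 != 0 -> (size (v ord0 0%R) <= N)%N ->
  exists (M : 'M[R]_(1 + c)) (g : 'M[R]_1), M \in unitmx /\ M *m v = col_mx g 0.
Proof.
elim: N v => [|N IHN] v v0; first by rewrite leqn0 size_poly_eq0 (negPf v0).
move=> sv; set v00 := v ord0 0 in v0 sv.
pose q : 'cV[R]_c := \col_i (v (rshift 1 i) 0 %/ v00).
pose rm : 'cV[R]_c := \col_i (v (rshift 1 i) 0 %% v00).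
pose M1 : 'M[R]_(1 + c) := block_mx 1%:M 0 (- q) 1%:M.
have uM1 : M1 \in unitmx by rewrite unitmxE det_lblock !det1 mulr1 unitr1.
have M1v : M1 *m v = col_mx v00%:M rm.
  rewrite -[v in LHS]vsubmxK mul_block_col !mul1mx mul0mx addr0.
  have -> : usubmx v = v00%:M.
    apply/matrixP=> i j; rewrite !ord1 !mxE eqxx mulr1n /v00; congr (v _ _).
    by apply/val_inj.
  congr col_mx; apply/matrixP=> i j; rewrite mul_mx_scalar !mxE !ord1.
  by apply/eqP; rewrite mulrN mulrC addrC subr_eq addrC -divp_eq.
have [rm0|] := eqVneq rm 0.
  by exists M1, v00%:M; split=> //; rewrite M1v rm0.
case/cV0Pn => i rmi.
pose M2 : 'M[R]_(1 + c) := tperm_mx ord0 (rshift 1 i).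
have uM2 : M2 \in unitmx by apply: unitmx_perm.
set w := M2 *m (M1 *m v).
have w0 : w ord0 0 = rm i 0.
  by rewrite /w /M2 /tperm_mx -row_permE mxE tpermL M1v col_mxEd.
have w0_lt : (size (w ord0 ord0) <= N)%N.
  by rewrite w0 -ltnS; apply: leq_trans sv; rewrite mxE ltn_modp.
have [|M3 [g [uM3 M3w]]] := IHN w _ w0_lt; first by rewrite w0.
exists (M3 *m (M2 *m M1)), g; split; first by rewrite !unitmx_mul uM1 uM2 uM3.
by rewrite -!mulmxA.
Qed.

Lemma clear_column c (v : 'cV[R]_(1 + c)) : v != 0 ->
  exists (M : 'M[R]_(1 + c)) (g : 'M[R]_1), M \in unitmx /\ M *m v = col_mx g 0.
Proof.
case/cV0Pn => i vi.
pose M2 : 'M[R]_(1 + c) := tperm_mx ord0 i.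
have uM2 : M2 \in unitmx by apply: unitmx_perm.
have w0 : (M2 *m v) ord0 0 = v i 0.
  by rewrite /M2 /tperm_mx -row_permE mxE tpermL.
have [|M3 [g [uM3 M3w]]] := @clear_column_ind c _ (M2 *m v) _ (leqnn _).
  by rewrite w0.
exists (M3 *m M2), g; split; first by rewrite !unitmx_mul uM2 uM3.
by rewrite -!mulmxA.
Qed.

Lemma echelon c d (a : 'M[R]_(c, d)) :
  exists M : 'M[R]_c, [/\ M \in unitmx,
    forall (i : 'I_c) (j : 'I_d), (mrank a <= i)%N -> (M *m a) i j = 0 &
    forall (i : 'I_c) (j : 'I_d), (j < i)%N -> (M *m a) i j = 0].
Proof.
elim: d c a => [|d IHd] c a.
  by exists 1%:M; split=> [|? []|? []]; rewrite ?unitmx1.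
rewrite -[d.+1]/(1 + d)%N in a *; rewrite -[a]hsubmxK.
set u := lsubmx a; set a' := rsubmx a.
have [u0|u0] := eqVneq u 0.
  have [M [uM Mr Mt]] := IHd c a'; exists M.
  have rk : mrank (row_mx u a') = mrank a'.
    apply/eqP; rewrite eqn_leq; apply/andP; split.
      have -> : row_mx u a' = a' *m row_mx 0 1%:M.
        by rewrite mul_mx_row mulmx0 mulmx1 u0.
      exact: mrank_mul_le_l.
    have {1}-> : a' = row_mx u a' *m col_mx 0 1%:M.
      by rewrite mul_row_col mulmx0 mulmx1 add0r.
    exact: mrank_mul_le_l.
  split=> // i j; rewrite ?rk mul_mx_row u0 mulmx0.
    by move=> ri; case: (split_ordP j) => j' ->; rewrite ?row_mxEl ?row_mxEr; [rewrite mxE | apply: Mr].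
  case: (split_ordP j) => j' ->; rewrite ?row_mxEl ?row_mxEr; first by rewrite mxE.
  by move=> /= ji; apply: Mt; apply: ltn_trans ji; rewrite add1n.
case: c a u a' u0 => [|c] a u a' u0.
  by exists 1%:M; split=> [|[]|[]]; rewrite ?unitmx1.
rewrite -[c.+1]/(1 + c)%N in a u a' u0 *.
have [M1 [g [uM1 M1u]]] := clear_column u0.
have g0 : g != 0.
  apply: contra_neq u0 => g0; rewrite -[u](mulKmx uM1) M1u g0 col_mx0 mulmx0 //.
set b := usubmx (M1 *m a'); set a2 := dsubmx (M1 *m a').
have M1a : M1 *m row_mx u a' = block_mx g b 0 a2.
  by rewrite mul_mx_row M1u -[M1 *m a']vsubmxK block_mxEh.
have [M2 [uM2 M2r M2t]] := IHd c a2.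
pose M : 'M[R]_(1 + c) := block_mx 1%:M 0 0 M2.
have ME : (M *m M1) *m row_mx u a' = block_mx g b 0 (M2 *m a2).
  by rewrite -mulmxA M1a /M mulmx_block !mulmx0 !mul0mx !mul1mx !addr0 add0r.
have rk : mrank (row_mx u a') = (mrank a2).+1.
  by rewrite -(mrank_unit _ uM1) M1a mrank_block_triangular.
exists (M *m M1); rewrite ME rk; split=> [|i j|i j].
- rewrite unitmx_mul uM1 andbT unitmxE det_ublock det1 mul1r -unitmxE //.
- case: (split_ordP i) => i' -> /=; first by rewrite ord1.
  rewrite add1n ltnS => ri; case: (split_ordP j) => j' ->.
    by rewrite block_mxEdl mxE.
  by rewrite block_mxEdr M2r.
- case: (split_ordP i) => i' -> /=; first by rewrite ord1.
  case: (split_ordP j) => j' -> /= ji.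
    by rewrite block_mxEdl mxE.
  by rewrite block_mxEdr M2t // -ltnS -!add1n.
Qed.

(** The nonzero rows [T] of an echelon form of [E] give [E = P *m T]; since [T]
    has full rank, it can be cancelled from [T *m P *m T = T]. *)
Lemma idempotent_factor_poly m (E : 'M[R]_m) : E *m E = E ->
  exists (P : 'M[R]_(m, mrank E)) (Q : 'M[R]_(mrank E, m)),
    P *m Q = E /\ Q *m P = 1%:M.
Proof.
move=> EE; have [M [uM Mr _]] := echelon E; set r := mrank E in Mr *.
have le_r : (r <= m)%N by apply: rank_leq_row.
pose I1 : 'M[R]_(m, r) := pid_mx r; pose I2 : 'M[R]_(r, m) := pid_mx r.
have I12 : I1 *m I2 = pid_mx r by rewrite mul_pid_mx !minnn.
have I21 : I2 *m I1 = 1%:M.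
  by rewrite mul_pid_mx minnn (minn_idPr le_r) pid_mx_1.
pose T := I2 *m (M *m E); pose P := invmx M *m I1.
have PT : P *m T = E.
  rewrite /P /T -!mulmxA (mulmxA I1) I12.
  suff -> : pid_mx r *m (M *m E) = M *m E by rewrite mulKmx.
  apply/matrixP=> i j; rewrite mxE (bigD1 i) //= big1 ?addr0.
    rewrite [pid_mx _ _ _]mxE eqxx /=; case: ltnP => ir; first by rewrite mul1r.
    by rewrite Mr ?mul0r.
  by move=> i'; rewrite -val_eqE /= => i'i; rewrite [pid_mx _ _ _]mxE eq_sym (negPf i'i) mul0r.
exists P, T; split=> //; apply: mrank_cancel.
  apply/eqP; rewrite eqn_leq rank_leq_row /=.
  by rewrite -[X in (X <= _)%N]/(mrank E) -{1}PT mrank_mul_le_r.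
have : P *m (T *m P *m T) = P *m T by rewrite (mulmxA P) (mulmxA P) PT -(mulmxA E) PT EE.
have QP : I2 *m M *m P = 1%:M by rewrite -mulmxA /P mulKVmx.
by move/(congr1 (mulmx (I2 *m M))); rewrite (mulmxA _ P) (mulmxA _ P T) QP !mul1mx.
Qed.

(** Once [a] is upper triangular, adding [g *: a] to the identity moved one row
    down leaves a unitriangular block, whatever [g] is.  This takes one row more
    than there are columns. *)
Lemma generic_left_inverse r (a : 'M[R]_(1 + r, r)) :
  exists b : 'M[R]_(1 + r, r), forall g : R,
    exists L : 'M[R]_(r, 1 + r), L *m (b + g *: a) = 1%:M.
Proof.
have [M [uM _ Mt]] := echelon a.
exists (invmx M *m col_mx 0 1%:M) => g.
pose sel : 'M[R]_(r, 1 + r) := row_mx 0 1%:M.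
set Y := sel *m (M *m (invmx M *m col_mx 0 1%:M + g *: a)).
suff uY : Y \in unitmx.
  by exists (invmx Y *m (sel *m M)); rewrite -2!mulmxA mulVmx.
have YE : Y = 1%:M + g *: dsubmx (M *m a).
  rewrite /Y mulmxDr mulKVmx // -scalemxAr mulmxDr -scalemxAr.
  by rewrite mul_row_col mul0mx add0r mul1mx -{1}[M *m a]vsubmxK mul_row_col mul0mx add0r mul1mx.
have [D [D0 {}YE]] : exists D : 'M[R]_r,
    (forall i j : 'I_r, (j <= i)%N -> D i j = 0) /\ Y = 1%:M + g *: D.
  exists (dsubmx (M *m a)); split=> // i j ji.
  by rewrite mxE Mt //= add1n.
rewrite -unitmx_tr unitmxE det_trig.
  by rewrite big1 ?unitr1 // => i _; rewrite YE !mxE eqxx D0 ?mulr0 ?addr0.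
apply/is_trig_mxP => i j ij; rewrite YE !mxE D0 ?mulr0 ?addr0 ?(ltnW ij) //.
by rewrite -val_eqE /= gtn_eqF.
Qed.

End Echelon.

(** * Residue fields *)

Section ResidueField.
Local Open Scope quotient_scope.
Variables (R : comNzRingType) (M : R -> Prop).
Hypotheses (idM : is_ideal M) (M1 : ~ M 1).
Hypothesis M_max : forall x, ~ M x -> exists a, M (1 - a * x).

Definition max_pred (x : R) : bool := `[<M x>].

Lemma max_pred_closed : idealr_closed max_pred.
Proof.
split; first by apply/asboolP; exact: (ideal0 idM).
  by apply/negP => /asboolP.
move=> a x y /asboolP Mx /asboolP My; apply/asboolP; apply: idealD => //.
exact: idealMl.
Qed.

HB.instance Definition _ := isIdealr.Build R max_pred max_pred_closed.

Definition residue := {ideal_quot (max_pred : idealr R)}.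

HB.instance Definition _ := GRing.ComNzRing.on residue.

Lemma residue_eq0 (x : R) : \pi_residue x = 0 <-> M x.
Proof.
rewrite -[0](rmorph0 \pi_residue); split.
  by move/eqP; rewrite -Quotient.idealrBE subr0 => /asboolP.
by move=> Mx; apply/eqP; rewrite -Quotient.idealrBE subr0; apply/asboolP.
Qed.

Lemma residue_inv (x : residue) : exists y : residue, if x == 0 then y == 0 else y * x == 1.
Proof.
have [_|x0] := eqVneq x 0; first by exists 0.
have nMx : ~ M (repr x).
  by move/residue_eq0; rewrite reprK; apply/eqP.
have [a Ma] := M_max nMx; exists (\pi_residue a).
move/residue_eq0: Ma; rewrite rmorphB rmorph1 rmorphM /= reprK => /eqP.
by rewrite subr_eq0 eq_sym.
Qed.

Definition residue_inverse x := xchoose (residue_inv x).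

Lemma residue_mulVf : forall x, x != 0 -> residue_inverse x * x = 1.
Proof.
move=> x /negPf x0; have := xchooseP (residue_inv x).
by rewrite -/(residue_inverse x); case: eqP x0 => // _ _ /eqP.
Qed.

Lemma residue_inv0 : residue_inverse 0 = 0.
Proof.
have := xchooseP (residue_inv 0).
by rewrite -/(residue_inverse 0); case: eqP => // _ /eqP.
Qed.

HB.instance Definition _ :=
  GRing.ComNzRing_isField.Build residue residue_mulVf residue_inv0.

Lemma residue_field :
  exists (k : fieldType) (h : {rmorphism R -> k}),
    (forall y, exists x, h x = y) /\ forall x, M x -> h x = 0.
Proof.
exists residue, \pi_residue; split=> [y|x /residue_eq0 //].
by exists (repr y); apply: reprK.
Qed.

End ResidueField.

(** The residue field of a maximal ideal containing [I], given by Zorn's lemma. *)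
Lemma proper_ideal_residue (R : comNzRingType) (I : R -> Prop) :
  is_ideal I -> ~ I 1 ->
  exists (k : fieldType) (h : {rmorphism R -> k}),
    (forall y, exists x, h x = y) /\ forall x, I x -> h x = 0.
Proof.
move=> idI I1.
pose proper (A : R -> Prop) := [/\ is_ideal A, forall x, I x -> A x & ~ A 1].
(* The empty set is admitted because it is the union of the empty chain. *)
pose P (A : R -> Prop) := (forall x, ~ A x) \/ proper A.
have [|M [PM M_max]] := @classical_sets.Zorn_bigcup R P.
  move=> F PF totF.
  have [[A FA [a Aa]]|noF] := pselect (exists2 A, F A & exists a, A a); last first.
    by left=> x [A FA Ax]; apply: noF; exists A => //; exists x.
  have properF B x : F B -> B x -> proper B.
    by move=> FB Bx; have [/(_ x)|] := PF _ FB.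
  have [idA IA A1] := properF _ _ FA Aa.
  right; split; last 1 first.
  - by move=> [B FB B1]; have [_ _ /(_ B1)] := properF _ _ FB B1.
  - split.
    + by exists A => //; apply: ideal0.
    + move=> x y [B FB Bx] [C FC Cy].
      have [idB _ _] := properF _ _ FB Bx; have [idC _ _] := properF _ _ FC Cy.
      have [BC|CB] := totF _ _ FB FC.
        by exists C => //; apply: idealD => //; apply: BC.
      by exists B => //; apply: idealD => //; apply: CB.
    + move=> b x [B FB Bx]; have [idB _ _] := properF _ _ FB Bx.
      by exists B => //; apply: idealMl.
  - by move=> x Ix; exists A => //; apply: IA.
have sI A : (forall x, M x -> A x) -> proper A -> forall x, A x -> M x.
  move=> MA pA x Ax; apply: contrapT => nMx; apply: (M_max A); last by right.
  split; last by move/(_ _ Ax).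
  by move=> y; apply: MA.
have pM : proper M.
  case: PM => // M0; have pI : proper I by [].
  have [] := M0 0; apply: (sI I) => //; [by move=> x /M0 | exact: ideal0].
have [idM IM M1] := pM.
have [|k [h [h_surj hM]]] := residue_field idM M1; last first.
  by exists k, h; split=> // x /IM; apply: hM.
move=> x nMx; apply: contrapT => noa; apply: nMx.
apply: (sI (fun y => exists a m, M m /\ y = a * x + m)).
- by move=> m Mm; exists 0, m; rewrite mul0r add0r.
- split; last 1 first.
  + move=> [a [m [Mm E]]]; apply: noa; exists a.
    by rewrite E addrAC subrr add0r.
  + split; first by exists 0, 0; rewrite mul0r add0r; split=> //; apply: ideal0.
      move=> _ _ [a [m [Mm ->]]] [b [m' [Mm' ->]]]; exists (a + b), (m + m').
      by split; [apply: idealD | rewrite mulrDl addrACA].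
    move=> c _ [a [m [Mm ->]]]; exists (c * a), (c * m).
    by split; [apply: idealMl | rewrite mulrDr mulrA].
  + by move=> y /IM My; exists 0, y; rewrite mul0r add0r.
- by exists 1, 0; rewrite mul1r addr0; split=> //; apply: ideal0.
Qed.

(** * Horrocks's theorem *)

Lemma resultant_map (aR rR : nzRingType) (h : {rmorphism aR -> rR}) (p q : {poly aR}) :
    h (lead_coef p) != 0 -> h (lead_coef q) != 0 ->
  h (resultant p q) = resultant (map_poly h p) (map_poly h q).
Proof.
move=> hp hq; rewrite /resultant /Sylvester_mx !size_map_poly_id0 //.
rewrite -det_map_mx /= map_col_mx; congr (\det (col_mx _ _));
  by apply: map_lin1_mx => v; rewrite map_poly_rV rmorphM /= map_rVpoly.
Qed.

(** In the Leibniz formula, the product of the diagonal entries has a larger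
    degree than all the other products. *)
Lemma det_dominant_monic (R : idomainType) n D (M : 'M[{poly R}]_n) :
  (forall i, M i i \is monic /\ size (M i i) = D.+1) ->
  (forall i j, i != j -> (size (M i j) <= D)%N) ->
  \det M \is monic.
Proof.
move=> Md Mo; rewrite /determinant (bigD1 1%g) //= odd_perm1 expr0 mul1r.
have diag_monic : \prod_i M i i \is monic.
  by apply: monic_prod => i _; have [] := Md i.
under eq_bigr => i _ do rewrite perm1.
set rest := \sum_(_ | _) _.
have size_diag : size (\prod_i M i i) = (n * D).+1.
  rewrite size_prod => [|i _]; last by rewrite monic_neq0 //; have [] := Md i.
  under eq_bigr => i _ do rewrite (Md i).2.
  by rewrite sum_nat_const card_ord mulnS -addnS addKn.
have size_rest : (size rest <= n * D)%N.
  apply: (leq_trans (size_sum _ _ _)); apply/bigmax_leqP => s s1.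
  have [i si] : exists i, s i != i.
    apply/existsP; apply: contraNT s1 => /existsPn s1.
    by apply/eqP/permP=> i; rewrite perm1; apply/eqP/negPn.
  rewrite mulr_sign; have -> : size (if s then - \prod_i M i (s i) else \prod_i M i (s i))
      = size (\prod_i M i (s i)) by case: ifP; rewrite ?size_polyN.
  apply: (leq_trans (size_prod_leq _ _)); rewrite leq_subLR card_ord -mulnS.
  rewrite (bigD1 i) //= -addSn; have -> : (n * D.+1 = D.+1 + n.-1 * D.+1)%N.
    by rewrite -mulSn prednK // (leq_ltn_trans _ (ltn_ord i)).
  apply: leq_add; first by rewrite ltnS Mo // eq_sym.
  have -> : (n.-1 * D.+1 = \sum_(j < n | j != i) D.+1)%N.
    by rewrite sum_nat_const cardC1 card_ord.
  apply: leq_sum => j ji; have [js|jsj] := eqVneq j (s j); last exact/leqW/Mo.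
  by rewrite -js (Md j).2.
rewrite monicE lead_coefDl ?size_diag ?ltnS //; exact: diag_monic.
Qed.

(** A nonzero column of [M] divided by its content is primitive, and the
    vanishing of the 2-minors makes all the columns multiples of it. *)
Lemma rank1_factor (R : idomainType) l m (M : 'M[R]_(l, m)) i0 j0 :
  has_contents R -> (mrank M <= 1)%N -> M i0 j0 != 0 ->
  exists (c : 'cV[R]_l) (d : 'rV[R]_m), M = c *m d.
Proof.
move=> Rc rM M0.
have minor2 i j : M i j * M i0 j0 = M i0 j * M i j0.
  pose F := map_mx (@tofrac R) M.
  have FE i' j' : tofrac (M i' j') = F i' j' by rewrite mxE.
  apply/eqP; rewrite -tofrac_eq !tofracM !FE; apply/eqP.
  have [C [D ->]] : exists (C : 'cV_l) (D : 'rV_m), F = C *m D.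
    have := mulmx_base F; have : (\rank F <= 1)%N by [].
    case: (\rank F) (col_base F) (row_base F) => [|[|//]] C D _ <-.
      by exists 0, 0; rewrite mulmx0; apply/matrixP=> ? ?; rewrite !mxE big_ord0.
    by exists C, D.
  by rewrite !mxE !big_ord1 mulrACA [RHS]mulrACA; congr (_ * _); rewrite mulrC.
have [|g [c [cE c_prim]]] := Rc [seq M i j0 | i <- enum 'I_l].
  by apply/hasP; exists (M i0 j0) => //; apply: map_f; rewrite mem_enum.
have sc : size c = l by have := congr1 size cE; rewrite size_map [RHS]size_map size_enum_ord.
have ME (i : 'I_l) : M i j0 = g * c`_i.
  have := congr1 (fun s => s`_i) cE; rewrite (nth_map i0) ?size_enum_ord //.
  by rewrite nth_ord_enum (nth_map 0) ?sc.
have [g0 c0] : g != 0 /\ c`_i0 != 0.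
  by apply/andP; rewrite -negb_or -mulf_eq0 -ME.
have col_eq i j : M i j * c`_i0 = M i0 j * c`_i.
  by apply: (mulfI g0); have := minor2 i j; rewrite !ME mulrCA [RHS]mulrCA.
have dvd_row j : exists q, M i0 j == q * c`_i0.
  have [|q qE] := c_prim (M i0 j) c`_i0; last by exists q; rewrite qE.
  move=> _ /(nthP 0) [i li <-]; rewrite sc in li.
  by exists (M (Ordinal li) j); rewrite -(col_eq (Ordinal li)).
exists (\col_i c`_i), (\row_j xchoose (dvd_row j)).
apply/matrixP=> i j; rewrite mxE big_ord1 !mxE; apply: (mulIf c0).
move: (xchoose _) (eqP (xchooseP (dvd_row j))) => x xE.
by rewrite col_eq xE mulrAC (mulrC x).
Qed.

Section Horrocks.
Variables (A : idomainType) (k : fieldType) (h : {rmorphism A -> k}).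
Hypothesis h_surj : forall y, exists x, h x = y.
Notation hp := (map_poly h).

Lemma map_poly_surj (p : {poly k}) : exists q : {poly A}, hp q = p.
Proof.
elim/poly_ind: p => [|p c [q <-]]; first by exists 0; rewrite rmorph0.
have [a <-] := h_surj c; exists (q * 'X + a%:P).
by rewrite rmorphD rmorphM /= map_polyX map_polyC.
Qed.

Lemma map_mx_poly_surj m n (M : 'M[{poly k}]_(m, n)) :
  exists N : 'M[{poly A}]_(m, n), map_mx hp N = M.
Proof.
have sur i j : exists q : {poly A}, hp q == M i j.
  by have [q <-] := map_poly_surj (M i j); exists q.
exists (\matrix_(i, j) xchoose (sur i j)); apply/matrixP=> i j.
by rewrite !mxE; apply/eqP/(xchooseP (sur i j)).
Qed.

(** The constants [s] allowed here are those of the ideal of all [y] such that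
    [y%:M = L *m W] for some [L].  It contains the monic polynomial [g] and a
    polynomial [z] that reduces to [1], hence the monic polynomial
    [w = z + 'X^N * g].  The resultant of [g] and [w] is in the ideal, and its
    image is the resultant of the reductions, which are coprime.  This replaces
    Nakayama's lemma over the localisation of [A] at the kernel of [h]. *)
Lemma left_inverse_lift m r (W : 'M[{poly A}]_(m, r)) (L0 : 'M[{poly A}]_(r, m))
    (L1 : 'M[{poly k}]_(r, m)) (g : {poly A}) :
  g \is monic -> L0 *m W = g%:M -> L1 *m map_mx hp W = 1%:M ->
  exists s L, h s != 0 /\ L *m W = s%:P%:M.
Proof.
move=> g_monic L0W L1W; have [L2 L2E] := map_mx_poly_surj L1.
pose z := \det (L2 *m W).
have hz : hp z = 1 by rewrite -det_map_mx map_mxM L2E L1W det1.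
pose L3 := \adj (L2 *m W) *m L2.
have L3W : L3 *m W = z%:M by rewrite -mulmxA mul_adj_mx.
have [sg|sg] := leqP (size g) 1.
  have g1 : g = 1.
    have gC := size1_polyC sg; move: (monicP g_monic).
    by rewrite [X in lead_coef X]gC lead_coefC => g01; rewrite gC g01.
  by exists 1, L0; rewrite rmorph1 oner_neq0 L0W g1.
pose N := size z; pose w := z + 'X^N * g.
have size_Xg : size ('X^N * g) = (N + size g)%N.
  by rewrite mulrC size_mulXn ?monic_neq0.
have lt_z : (size z < size ('X^N * g)%R)%N.
  by rewrite size_Xg -addn1 leq_add2l ltnW.
have w_monic : w \is monic.
  by rewrite monicE /w addrC lead_coefDl // -monicE monicMl ?monicXn.
have sw : (1 < size w)%N.
  by rewrite /w addrC size_polyDl // size_Xg (leq_trans sg) ?leq_addl.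
have [[u v] /= _ resE] := resultant_in_ideal sg sw.
exists (resultant g w), ((u + v * 'X^N) *: L0 + v *: L3); split; last first.
  rewrite mulmxDl -!scalemxAl L0W L3W !scale_scalar_mx -raddfD /=; congr (_%:M).
  by rewrite resE /w mulrDl mulrDr -!mulrA -!addrA; congr (_ + _); rewrite addrC.
rewrite resultant_map ?(monicP g_monic) ?(monicP w_monic) ?rmorph1 ?oner_neq0 //.
rewrite resultant_eq0 -leqNgt.
set d := Pdiv.Idomain.gcdp _ _; have : d %| 1.
  rewrite -hz; have -> : hp z = hp w - 'X^N * hp g.
    by rewrite /w rmorphD rmorphM /= map_polyXn addrK.
  by rewrite dvdp_sub ?dvdp_mull ?dvdp_gcdl ?dvdp_gcdr.
by rewrite dvdp1 => /eqP ->.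
Qed.

(** The image of [E] becomes free of rank [r] once [s] is inverted.  The columns
    of [W] are [r - 1] elements of this image that are part of a basis: they are
    [E *m (q + 'X^N *: p)], where
    - [p] comes from the adjugate of the given submatrix of [E], so that for
      large [N] some maximal minor of [W] is monic;
    - [q] is lifted from the residue field so that the reduction of [W] has a
      left inverse, whatever [N] is.
    The complement of their span has rank 1, and is free because [A[x]] has
    contents. *)
Lemma horrocks m r (E : 'M[{poly A}]_m) (f g : 'I_r -> 'I_m) :
  has_contents {poly A} -> E *m E = E -> mrank E = r -> mrank (map_mx hp E) = r ->
  lead_coef (\det (mxsub f g E)) \is a GRing.unit ->
  exists (s : A) (P : 'M[{poly A}]_(m, r)) (Q : 'M[{poly A}]_(r, m)),
    [/\ h s != 0, Q *m P = s%:P%:M & P *m Q = s%:P *: E].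
Proof.
move=> Ac EE; case: r f g => [|r] f g rE rEk unit_minor.
  exists 1, 0, 0; rewrite rmorph1 oner_neq0; split=> //.
    by apply/matrixP=> -[].
  move: rE; rewrite /mrank mulmx0 => /eqP; rewrite mxrank_eq0 => /eqP E0.
  by apply: map_tofrac_inj; rewrite /= map_mxZ E0 scaler0 raddf0.
rewrite -[r.+1]/(1 + r)%N in f g rE rEk unit_minor *.
set Eb := map_mx hp E in rEk.
have EEb : Eb *m Eb = Eb by rewrite -map_mxM EE.
have [Pb [Qb [PQb QPb]]] : exists (Pb : 'M[{poly k}]_(m, 1 + r)) (Qb : 'M[{poly k}]_(1 + r, m)),
    Pb *m Qb = Eb /\ Qb *m Pb = 1%:M.
  by have := idempotent_factor_poly EEb; rewrite rEk.
pose c := (lead_coef (\det (mxsub f g E)))^-1.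
pose Del := c *: \det (mxsub f g E).
have Del_monic : Del \is monic by rewrite monicE lead_coefZ mulVr.
pose G0 : 'M[{poly A}]_(1 + r, m) := rowsub f 1%:M.
pose H0 : 'M[{poly A}]_(m, 1 + r) := colsub g 1%:M.
have GEH : G0 *m E *m H0 = mxsub f g E.
  by rewrite /G0 /H0 mul_rowsub_mx mul1mx mulmx_colsub mulmx1; apply/matrixP=> i j; rewrite !mxE.
pose T0 : 'M[{poly A}]_(r, 1 + r) := row_mx 0 1%:M.
pose S0 : 'M[{poly A}]_(1 + r, r) := col_mx 0 1%:M.
have TS : T0 *m S0 = 1%:M by rewrite mul_row_col mul0mx add0r mul1mx.
(* [G *m E *m p] is a scalar matrix, with the monic polynomial [Del] on the
   diagonal. *)
pose p := H0 *m (c%:P *: \adj (mxsub f g E)) *m S0.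
pose G := T0 *m G0.
have GEp : G *m E *m p = Del%:M.
  rewrite /G /p -!mulmxA (mulmxA E) (mulmxA G0) (mulmxA G0 E) GEH.
  rewrite -scalemxAl -scalemxAr (mulmxA (mxsub _ _ _)) mul_mx_adj.
  by rewrite mul_scalar_mx scalerA -scalemxAr TS scalemx1 /Del mul_polyC.
have [b b_left] := generic_left_inverse (Qb *m map_mx hp p).
have [q qE] := map_mx_poly_surj (Pb *m b).
pose N := \sum_i \sum_j size ((G *m E *m q) i j).
have [W WE] : exists W, W = E *m (q + 'X^N *: p) by eexists.
have EW : E *m W = W by rewrite WE mulmxA EE.
have [L1 L1W] : exists L1 : 'M[{poly k}]_(r, m), L1 *m map_mx hp W = 1%:M.
  have [L LE] := b_left 'X^N; exists (L *m Qb).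
  rewrite WE map_mxM map_mxD map_mxZ /= map_polyXn qE -/Eb -PQb -!mulmxA.
  by rewrite (mulmxA Qb Pb) QPb mul1mx mulmxDr (mulmxA Qb Pb) QPb mul1mx -scalemxAr.
have GW_monic : \det (G *m W) \is monic.
  have size_N i j : (size ((G *m E *m q) i j) <= N)%N.
    by rewrite /N (bigD1 i) //= (leq_trans _ (leq_addr _ _)) // (bigD1 j) //= leq_addr.
  have GWE : G *m W = G *m E *m q + ('X^N * Del)%:M.
    by rewrite WE mulmxA mulmxDr -scalemxAr GEp scale_scalar_mx.
  have Del_gt0 : (0 < size Del)%N by rewrite size_poly_gt0 monic_neq0.
  have size_XD : size ('X^N * Del) = (N + (size Del).-1).+1.
    by rewrite mulrC size_mulXn ?monic_neq0 // -addnS prednK.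
  apply: (@det_dominant_monic _ _ (N + (size Del).-1)%N) => [i|i j ij]; rewrite GWE mxE.
    rewrite [_%:M i i]mxE eqxx mulr1n.
    have lt_i : (size ((G *m E *m q) i i) < size ('X^N * Del)%R)%N.
      by rewrite size_XD ltnS (leq_trans (size_N i i)) ?leq_addr.
    split; last by rewrite addrC size_polyDl.
    by rewrite monicE addrC lead_coefDl // -monicE monicMl ?monicXn.
  by rewrite [_%:M i j]mxE (negPf ij) addr0 (leq_trans (size_N i j)) ?leq_addr.
have [|s [L [hs LW]]] := @left_inverse_lift m r W (\adj (G *m W) *m G) L1 _ GW_monic _ L1W.
  by rewrite -mulmxA mul_adj_mx.
have s0 : s%:P != 0 :> {poly A}.
  by rewrite polyC_eq0; apply: contra_neq hs => ->; rewrite rmorph0.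
(* [W *m L *m E] is [s] times the projection of the image of [E] onto the span of
   [W]; [M] is [s] times the complementary projection. *)
have [M ME0] : exists M, M = s%:P *: E - W *m L *m E by eexists.
have LEW : L *m E *m W = s%:P%:M by rewrite -mulmxA EW.
have MW : M *m W = 0.
  rewrite ME0 mulmxBl -scalemxAl EW -!mulmxA (mulmxA L) LEW.
  by rewrite mul_mx_scalar subrr.
have ME : M *m E = M by rewrite ME0 mulmxBl -scalemxAl EE -(mulmxA _ E) EE.
have LEM : L *m E *m M = 0.
  rewrite ME0 mulmxBr -scalemxAr -(mulmxA L E E) EE -!(mulmxA W) (mulmxA (L *m E) W) LEW.
  by rewrite mul_scalar_mx subrr.
have MM : M *m M = s%:P *: M.
  by rewrite {2}ME0 mulmxBr -scalemxAr ME -!(mulmxA W) (mulmxA M W) MW mul0mx subr0.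
have rM : (mrank M <= 1)%N.
  pose fr n1 n2 (X : 'M[{poly A}]_(n1, n2)) := map_mx (@tofrac _) X.
  pose M' := fr _ _ M; pose L' := fr _ _ (L *m E); pose W' := fr _ _ W; pose E' := fr _ _ E.
  have LW' : L' *m W' = (tofrac s%:P)%:M by rewrite /L' /W' /fr -map_mxM LEW map_scalar_mx.
  have sF0 : tofrac s%:P != 0 by rewrite tofrac_eq0.
  have rL : \rank L' = r.
    apply/eqP; rewrite eqn_leq rank_leq_row.
    have := mxrankM_maxl L' W'; rewrite LW' -scalemx1 mxrank_scale_nz //.
    by rewrite mxrank1.
  have dis : (M' :&: L' = 0)%MS.
    apply/eqP; rewrite -submx0; apply/rV_subP => x.
    rewrite sub_capmx => /andP [/submxP [y xy] /submxP [z xz]].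
    have : x *m W' = 0 by rewrite xy -mulmxA /M' /W' /fr -map_mxM MW raddf0 mulmx0.
    rewrite xz -mulmxA LW' mul_mx_scalar => /eqP; rewrite scaler_eq0 (negPf sF0) /=.
    by move/eqP=> ->; rewrite mul0mx sub0mx.
  have : (M' + L' <= E')%MS.
    rewrite addsmx_sub /M' /L' /E' /fr -{1}ME !map_mxM.
    by rewrite !submxMl.
  move/mxrankS; rewrite mxrank_disjoint_sum // rL [\rank E']rE.
  by rewrite leq_add2r.
have [i0 [j0 M0]] : exists i j, M i j != 0.
  have : M != 0.
    apply/eqP=> M0; have : s%:P *: E = W *m (L *m E).
      by apply/eqP; rewrite mulmxA -subr_eq0 -ME0 M0.
    move/(congr1 (fun X => mrank X)).
    have -> : mrank (s%:P *: E) = (1 + r)%N.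
      by rewrite -rE /mrank map_mxZ mxrank_scale_nz // tofrac_eq0.
    move=> rk; have := mrank_mul_le_l W (L *m E); rewrite -rk /mrank => /leq_trans.
    by move=> /(_ _ (rank_leq_col _)); rewrite add1n ltnn.
  by case/matrix0Pn => i [j Mij]; exists i, j.
have [u [v MuvE]] := rank1_factor Ac rM M0.
have [u0 v0] : u i0 0 != 0 /\ v 0 j0 != 0.
  by apply/andP; move: M0; rewrite MuvE mxE big_ord1 mulf_eq0 negb_or.
have u_free n (X : 'rV_n) : u *m X = 0 -> X = 0.
  move=> uX; apply/matrixP=> i j; apply: (mulfI u0).
  have := congr1 (fun Y : 'M_(_, _) => Y i0 j) uX.
  by rewrite !mxE big_ord1 (ord1 i) mulr0.
have v_free n (X : 'cV_n) : X *m v = 0 -> X = 0.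
  move=> Xv; apply/matrixP=> i j; apply: (mulIf v0).
  have := congr1 (fun Y : 'M_(_, _) => Y i j0) Xv.
  by rewrite !mxE big_ord1 (ord1 j) mul0r.
have vu : v *m u = s%:P%:M.
  apply/eqP; rewrite -subr_eq0; apply/eqP/u_free/v_free.
  have uvu : u *m (v *m u) *m v = M *m M by rewrite MuvE !mulmxA.
  by rewrite mulmxBr mulmxBl uvu MM mul_mx_scalar -scalemxAl -MuvE subrr.
have vW : v *m W = 0 by apply: u_free; rewrite mulmxA -MuvE.
have LEu : L *m E *m u = 0 by apply: v_free; rewrite -(mulmxA _ u) -MuvE.
exists s, (row_mx u W), (col_mx v (L *m E)); split=> //.
  by rewrite mul_col_row vu vW LEu LEW -scalar_mx_block.
by rewrite mul_row_col -MuvE ME0 mulmxA subrK.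
Qed.

End Horrocks.

(** * Quillen patching *)

Definition similar_mx (R : comUnitRingType) m (E E' : 'M[R]_m) :=
  exists2 V : 'M[R]_m, V \in unitmx & E *m V = V *m E'.

Section Similar.
Variables (R : comUnitRingType) (m : nat).
Implicit Types E : 'M[R]_m.

Lemma similar_refl E : similar_mx E E.
Proof. by exists 1%:M; rewrite ?unitmx1 // mulmx1 mul1mx. Qed.

Lemma similar_trans E2 E1 E3 : similar_mx E1 E2 -> similar_mx E2 E3 -> similar_mx E1 E3.
Proof.
move=> [V uV VE] [W uW WE]; exists (V *m W); first by rewrite unitmx_mul uV.
by rewrite mulmxA VE -!mulmxA WE.
Qed.

End Similar.

Lemma similar_map (R R' : comUnitRingType) (h : {rmorphism R -> R'}) m (E E' : 'M[R]_m) :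
  similar_mx E E' -> similar_mx (map_mx h E) (map_mx h E').
Proof.
move=> [V uV VE]; exists (map_mx h V); last by rewrite -!map_mxM VE.
by rewrite unitmxE det_map_mx rmorph_unit -?unitmxE.
Qed.

(** Finitely generated projective modules over [R] are free. *)
Definition idempotents_split (R : comUnitRingType) :=
  forall m (E : 'M[R]_m), E *m E = E -> exists r, similar_mx E (pid_mx r).

Lemma idempotents_split_iso (R R' : comUnitRingType)
    (f : {rmorphism R -> R'}) (g : {rmorphism R' -> R}) :
  cancel g f -> idempotents_split R -> idempotents_split R'.
Proof.
move=> gK Rs m E EE; have [|r Er] := Rs m (map_mx g E).
  by rewrite -map_mxM EE.
exists r; have := similar_map f Er; rewrite map_pid_mx.
suff -> : map_mx f (map_mx g E) = E by [].
by apply/matrixP=> i j; rewrite !mxE gK.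
Qed.

Section Patching.
Variables (A : idomainType) (m : nat) (E : 'M[{poly A}]_m).

Notation at_poly u := (map_mx (comp_poly u)).

(** Quillen's ideal: the translations under which [E] does not change up to
    similarity.  It contains [1] exactly when [E] is similar to its value at [0]. *)
Definition patching_ideal (a : A) : Prop :=
  forall u v : {poly A}, similar_mx (at_poly (u + a *: v) E) (at_poly u E).

Lemma patching_idealP : is_ideal patching_ideal.
Proof.
split=> [u v|a b Ia Ib u v|c a Ia u v].
- by rewrite scale0r addr0; apply: similar_refl.
- by rewrite scalerDl addrA; apply: similar_trans (Ib _ _) (Ia _ _).
- by rewrite mulrC -scalerA.
Qed.

Lemma comp_poly_taylor (p u t : {poly A}) : exists q, p \Po (u + t) = p \Po u + t * q.
Proof.
elim/poly_ind: p => [|p c [q qE]]; first by exists 0; rewrite !comp_poly0 mulr0 addr0.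
exists (p \Po u + q * u + t * q).
rewrite !comp_polyD !comp_polyM !comp_polyX !comp_polyC qE.
ring.
Qed.

Lemma at_poly_taylor (W : 'M[{poly A}]_m) u t :
  exists Z, at_poly (u + t) W = at_poly u W + t *: Z.
Proof.
have tay i j : exists q, W i j \Po (u + t) == W i j \Po u + t * q.
  by have [q ->] := comp_poly_taylor (W i j) u t; exists q.
exists (\matrix_(i, j) xchoose (tay i j)); apply/matrixP=> i j.
by rewrite !mxE; apply/eqP/(xchooseP (tay i j)).
Qed.

(** Inverting [s] makes [V *m U] the identity up to a scalar and [E] similar to
    the constant matrix [D], so that [V(u + t)] and [U(u)] provide a similarity
    between [E(u + t)] and [E(u)].  Its denominators disappear when [t] is a
    multiple of [s * s], because [V(u + t) - V(u)] is a multiple of [t]. *)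
Lemma patching_ideal_local (U V : 'M[{poly A}]_m) (s : A) (D : 'M[A]_m) :
  s != 0 -> U *m V = s%:P%:M -> V *m U = s%:P%:M ->
  U *m E *m V = s%:P *: map_mx polyC D -> patching_ideal (s * s).
Proof.
move=> s0 UV VU UEV u v.
have sP0 : s%:P != 0 :> {poly A} by rewrite polyC_eq0.
have EV : E *m V = V *m map_mx polyC D.
  apply: (scalemx_inj sP0) => /=; rewrite -mul_scalar_mx -VU scalemxAr -UEV.
  by rewrite !mulmxA.
have UE : U *m E = map_mx polyC D *m U.
  apply: (scalemx_inj sP0) => /=; rewrite -mul_mx_scalar -VU mulmxA UEV.
  by rewrite -scalemxAl.
have atC w (X : 'M[A]_m) : at_poly w (map_mx polyC X) = map_mx polyC X.
  by apply/matrixP=> i j; rewrite !mxE comp_polyC.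
have atS w : at_poly w (s%:P%:M : 'M_m) = s%:P%:M.
  by rewrite map_scalar_mx /= comp_polyC.
set t := (s * s) *: v; set u' := u + t.
have tE : t = s%:P * (s%:P * v) by rewrite /t mulrA -polyCM mul_polyC.
have [Z ZE] := at_poly_taylor V u t; have [Z' Z'E] := at_poly_taylor U u t.
have UVat w : at_poly w U *m at_poly w V = s%:P%:M by rewrite -map_mxM UV atS.
have VUat w : at_poly w V *m at_poly w U = s%:P%:M by rewrite -map_mxM VU atS.
pose G := 1%:M + (s%:P * v) *: (Z *m at_poly u U).
pose H := 1%:M + (s%:P * v) *: (at_poly u V *m Z').
have GE : at_poly u' V *m at_poly u U = s%:P *: G.
  by rewrite ZE mulmxDl VUat -scalemxAl scalerDr scale_scalar_mx mulr1 scalerA -tE.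
have HE : at_poly u V *m at_poly u' U = s%:P *: H.
  by rewrite Z'E mulmxDr VUat -scalemxAr scalerDr scale_scalar_mx mulr1 scalerA -tE.
have GH : G *m H = 1%:M.
  apply: (scalemx_inj sP0); apply: (scalemx_inj sP0) => /=.
  rewrite scalemxAr scalemxAl -GE -HE -!mulmxA (mulmxA (at_poly u U)) UVat.
  by rewrite mul_scalar_mx -scalemxAr VUat scalemx1.
exists G; first by have [] := mulmx1_unit GH.
have EV' : at_poly u' E *m at_poly u' V = at_poly u' V *m map_mx polyC D.
  by rewrite -map_mxM EV map_mxM atC.
have UE' : at_poly u U *m at_poly u E = map_mx polyC D *m at_poly u U.
  by rewrite -map_mxM UE map_mxM atC.
apply: (scalemx_inj sP0) => /=; rewrite scalemxAr scalemxAl -GE mulmxA EV'.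
by rewrite -!mulmxA UE'.
Qed.

Lemma quillen_patching :
  (forall (k : fieldType) (h : {rmorphism A -> k}), (forall y, exists x, h x = y) ->
     exists (U V : 'M[{poly A}]_m) (s : A) (D : 'M[A]_m),
     [/\ h s != 0, U *m V = s%:P%:M, V *m U = s%:P%:M &
         U *m E *m V = s%:P *: map_mx polyC D]) ->
  similar_mx E (map_mx polyC (map_mx (horner_eval 0) E)).
Proof.
move=> loc; have I1 : patching_ideal 1.
  apply: contrapT => /(proper_ideal_residue patching_idealP) [k [h [h_surj hI]]].
  have [U [V [s [D [hs UV VU UEV]]]]] := loc k h h_surj.
  have s0 : s != 0 by apply: contra_neq hs => ->; rewrite rmorph0.
  have /eqP := hI _ (patching_ideal_local s0 UV VU UEV).
  by rewrite rmorphM mulf_eq0 (negPf hs).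
have := I1 0 'X; rewrite scale1r add0r.
have -> : at_poly 'X E = E by apply/matrixP=> i j; rewrite mxE comp_polyXr.
suff -> : at_poly 0 E = map_mx polyC (map_mx (horner_eval 0) E) by [].
by apply/matrixP=> i j; rewrite !mxE comp_poly0r horner_evalE horner_coef0.
Qed.

End Patching.

Lemma mrank_idempotent_le (R : idomainType) m (E : 'M[R]_m) : E *m E = E ->
  (mrank E + mrank (1%:M - E) <= m)%N.
Proof.
move=> EE; apply: mulmx0_rank_max; rewrite -map_mxM mulmxBr mulmx1 EE subrr.
exact: raddf0.
Qed.

Lemma mrank_idempotent (R : idomainType) m (E : 'M[R]_m) : E *m E = E ->
  (mrank E + mrank (1%:M - E))%N = m.
Proof.
move=> EE; apply/eqP; rewrite eqn_leq mrank_idempotent_le //=.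
rewrite -[X in (X <= _)%N](mxrank1 {fraction R}).
have -> : 1%:M = map_mx (@tofrac R) E + map_mx (@tofrac R) (1%:M - E).
  by rewrite -raddfD /= addrC subrK map_mx1.
exact: mxrank_add.
Qed.

Lemma idempotent_compl (R : pzRingType) m (E : 'M[R]_m) : E *m E = E ->
  (1%:M - E) *m (1%:M - E) = 1%:M - E.
Proof. by move=> EE; rewrite mulmxBl mul1mx mulmxBr mulmx1 EE subrr subr0. Qed.

(** The columns of [P] and [P'] are, up to the denominators [s] and [s'], bases
    of the images of [E] and of [1%:M - E]; together they form a basis of the
    whole module. *)
Lemma assemble_splitting (R : idomainType) r r' (E : 'M[R]_(r + r')) s s'
    (P : 'M[R]_(r + r', r)) (Q : 'M[R]_(r, r + r'))
    (P' : 'M[R]_(r + r', r')) (Q' : 'M[R]_(r', r + r')) :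
  E *m E = E -> s != 0 -> s' != 0 ->
  Q *m P = s%:M -> P *m Q = s *: E ->
  Q' *m P' = s'%:M -> P' *m Q' = s' *: (1%:M - E) ->
  let U := col_mx (s' *: Q) (s *: Q') in
  let V := row_mx P P' in
  [/\ U *m V = (s * s')%:M, V *m U = (s * s')%:M &
      U *m E *m V = (s * s') *: pid_mx r].
Proof.
move=> EE s0 s'0 QP PQ QP' PQ' U V.
have EP : E *m P = P.
  by apply: (scalemx_inj s0) => /=; rewrite scalemxAl -PQ -mulmxA QP mul_mx_scalar.
have QE : Q *m E = Q.
  by apply: (scalemx_inj s0) => /=; rewrite scalemxAr -PQ mulmxA QP mul_scalar_mx.
have EP' : E *m P' = 0.
  apply: (scalemx_inj s'0) => /=; rewrite scaler0 -mul_mx_scalar -QP' mulmxA -(mulmxA E) PQ'.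
  by rewrite -scalemxAr mulmxBr mulmx1 EE subrr scaler0 mul0mx.
have QE' : Q' *m E = 0.
  apply: (scalemx_inj s'0) => /=; rewrite scaler0 -mul_scalar_mx -QP' -mulmxA (mulmxA P') PQ'.
  by rewrite -scalemxAl mulmxBl mul1mx EE subrr scaler0 mulmx0.
have QP'0 : Q *m P' = 0 by rewrite -QE -mulmxA EP' mulmx0.
have Q'P0 : Q' *m P = 0 by rewrite -EP mulmxA QE' mul0mx.
split.
- rewrite mul_col_row -!scalemxAl QP QP'0 Q'P0 QP' !scaler0 !scale_scalar_mx.
  by rewrite mulrC -scalar_mx_block.
- rewrite mul_row_col -!scalemxAr PQ PQ' !scalerA [s' * s]mulrC -scalerDr.
  by rewrite addrC subrK scalemx1.
- rewrite -mulmxA mul_mx_row EP EP' mul_col_row -!scalemxAl QP Q'P0 !mulmx0 !scaler0.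
  rewrite pid_mx_block scale_block_mx !scaler0 scale_scalar_mx mulrC.
  by rewrite scalemx1.
Qed.

(** A minor with invertible leading coefficient stays nonzero in every residue
    field.  As the ranks of [E] and [1%:M - E] add up to their size, there and
    over the fraction field, both ranks are preserved by reduction. *)
Lemma idempotent_similar_poly (A : idomainType) m (E : 'M[{poly A}]_m) r r'
    (f g : 'I_r -> 'I_m) (f' g' : 'I_r' -> 'I_m) :
  idempotents_split A -> has_contents {poly A} ->
  E *m E = E -> mrank E = r -> mrank (1%:M - E) = r' ->
  lead_coef (\det (mxsub f g E)) \is a GRing.unit ->
  lead_coef (\det (mxsub f' g' (1%:M - E))) \is a GRing.unit ->
  exists q, similar_mx E (pid_mx q).
Proof.
move=> As Ac EE rE rE' ufg ufg'.
(* Both [E] and its complement are needed in order to obtain a square matrix of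
   base change. *)
have m_eq : m = (r + r')%N by rewrite -rE -rE' mrank_idempotent.
subst m; have [|q E0q] := As _ (map_mx (horner_eval 0) E).
  by rewrite -map_mxM EE.
exists q; apply: (@similar_trans _ _ (map_mx polyC (map_mx (horner_eval 0) E))); last first.
  by have := similar_map (@polyC A) E0q; rewrite map_pid_mx.
apply: quillen_patching => k h h_surj.
have EE' := idempotent_compl EE.
have hminor i (F : 'M[{poly A}]_(r + r')) (f0 g0 : 'I_i -> 'I_(r + r')) :
    lead_coef (\det (mxsub f0 g0 F)) \is a GRing.unit ->
    (i <= mrank (map_mx (map_poly h) F))%N.
  move=> uF; apply: (@minor_mrank _ _ _ _ _ f0 g0).
  rewrite -map_mxsub det_map_mx.
  have : h (lead_coef (\det (mxsub f0 g0 F))) != 0.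
    by rewrite -unitfE rmorph_unit.
  by apply: contra_neq => hd0; rewrite lead_coefE -coef_map hd0 coef0.
have le1 := hminor _ _ _ _ ufg; have le2 := hminor _ _ _ _ ufg'.
have hE1 : map_mx (map_poly h) (1%:M - E) = 1%:M - map_mx (map_poly h) E.
  by rewrite raddfB /= map_mx1.
have : (mrank (map_mx (map_poly h) E) + mrank (map_mx (map_poly h) (1%:M - E)) <= r + r')%N.
  by rewrite hE1; apply: mrank_idempotent_le; rewrite -map_mxM EE.
move=> le12; have rk1 : mrank (map_mx (map_poly h) E) = r.
  apply/eqP; rewrite eqn_leq le1 andbT -(leq_add2r r').
  by apply: leq_trans le12; rewrite leq_add2l.
have rk2 : mrank (map_mx (map_poly h) (1%:M - E)) = r'.
  apply/eqP; rewrite eqn_leq le2 andbT -(leq_add2l r).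
  by apply: leq_trans le12; rewrite leq_add2r.
have [s [P [Q [hs QP PQ]]]] := horrocks h_surj Ac EE rE rk1 ufg.
have [s' [P' [Q' [hs' QP' PQ']]]] := horrocks h_surj Ac EE' rE' rk2 ufg'.
have P0 (a : A) : h a != 0 -> a%:P != 0 :> {poly A}.
  by rewrite polyC_eq0; apply: contra_neq => ->; rewrite rmorph0.
have [UV VU UEV] := assemble_splitting EE (P0 _ hs) (P0 _ hs') QP PQ QP' PQ'.
exists (col_mx (s'%:P *: Q) (s%:P *: Q')), (row_mx P P'), (s * s'), (pid_mx r).
by rewrite rmorphM mulf_neq0 // polyCM map_pid_mx.
Qed.

Lemma idempotents_split_field (K : fieldType) : idempotents_split K.
Proof.
move=> m E EE.
have rank_sum : (\rank E + \rank (1%:M - E)%R)%N = m.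
  apply/eqP; rewrite eqn_leq; apply/andP; split.
    by apply: mulmx0_rank_max; rewrite mulmxBr mulmx1 EE subrr.
  rewrite -[X in (X <= _)%N](mxrank1 K m) -{1}[1%:M](subrK E) addrC.
  exact: mxrank_add.
have factor (F : 'M[K]_m) r : F *m F = F -> \rank F = r ->
    exists (P : 'M_(m, r)) (Q : 'M_(r, m)), Q *m P = 1%:M /\ P *m Q = 1 *: F.
  move=> FF <-; exists (col_base F), (row_base F); rewrite scale1r mulmx_base; split=> //.
  apply: (row_free_inj (row_base_free F)); rewrite /= mul1mx.
  apply: (row_full_inj (col_base_full F)).
  rewrite /= -(mulmxA (row_base F)) mulmx_base.
  by rewrite (mulmxA (col_base F) (row_base F)) mulmx_base FF.
have EE' := idempotent_compl EE.
have [r rE] : exists r, \rank E = r by eexists.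
have [r' rE'] : exists r', \rank (1%:M - E)%R = r' by eexists.
rewrite rE rE' in rank_sum; subst m.
have [P [Q [QP PQ]]] := factor _ _ EE rE.
have [P' [Q' [QP' PQ']]] := factor _ _ EE' rE'.
have [UV VU UEV] := assemble_splitting EE (oner_neq0 _) (oner_neq0 _) QP PQ QP' PQ'.
exists r, (row_mx P P'); rewrite mulr1 in UV VU UEV.
  by have [] := mulmx1_unit UV.
by rewrite -[pid_mx r]scale1r -UEV !mulmxA VU mul1mx.
Qed.

(** * Idempotent matrices over polynomial rings *)

Lemma rmorph_mpoly_ext (R : comNzRingType) n (S : comNzRingType)
    (f g : {rmorphism {mpoly R[n]} -> S}) :
  (forall a, f a%:MP = g a%:MP) -> (forall i, f 'X_i = g 'X_i) -> f =1 g.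
Proof.
move=> fgC fgX p; rewrite [p]mpolyE !rmorph_sum; apply: eq_bigr => m _.
rewrite -mul_mpolyC !rmorphM fgC mpolyXE_id !rmorph_prod; congr (_ * _).
by apply: eq_bigr => i _; rewrite !rmorphXn fgX.
Qed.

Lemma rmorph_poly_ext (R S : nzRingType) (f g : {rmorphism {poly R} -> S}) :
  (forall a, f a%:P = g a%:P) -> f 'X = g 'X -> f =1 g.
Proof.
move=> fgC fgX; elim/poly_ind => [|p c IHp]; first by rewrite !rmorph0.
by rewrite !rmorphD !rmorphM /= fgC fgX IHp.
Qed.

Section Coordinates.
Variables (K : fieldType) (n : nat).

Lemma linear_coordinates (c : 'I_n.+1 -> K) : c ord_max != 0 ->
  exists (Theta : {rmorphism {mpoly K[n.+1]} -> {poly {mpoly K[n]}}})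
         (Psi : {rmorphism {poly {mpoly K[n]}} -> {mpoly K[n.+1]}}),
    [/\ cancel Theta Psi, cancel Psi Theta,
        forall a, Theta a%:MP = (a%:MP)%:P,
        forall j, Theta 'X_(lift ord_max j) = ('X_j)%:P + (c (lift ord_max j))%:MP *: 'X &
        Theta 'X_ord_max = (c ord_max)%:MP *: 'X].
Proof.
move=> c0.
pose img (i : 'I_n.+1) : {poly {mpoly K[n]}} :=
  (if unlift ord_max i is Some j then ('X_j)%:P else 0) + (c i)%:MP *: 'X.
pose emb : {rmorphism K -> {poly {mpoly K[n]}}} := (@polyC _) \o (@mpolyC n K).
have [Theta [ThC ThX]] : exists Theta : {rmorphism {mpoly K[n.+1]} -> {poly {mpoly K[n]}}},
    (forall a, Theta a%:MP = (a%:MP)%:P) /\ forall i, Theta 'X_i = img i.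
  by exists (mmap emb img); split=> [a|i] /=; rewrite ?mmapC ?mmapX ?mmap1U.
pose Y : {mpoly K[n.+1]} := (c ord_max)^-1%:MP * 'X_ord_max.
pose back (j : 'I_n) : {mpoly K[n.+1]} :=
  'X_(lift ord_max j) - (c (lift ord_max j))%:MP * Y.
have [Back [BackC BackX]] : exists Back : {rmorphism {mpoly K[n]} -> {mpoly K[n.+1]}},
    (forall a, Back a%:MP = a%:MP) /\ forall i, Back 'X_i = back i.
  by exists (mmap (@mpolyC n.+1 K) back); split=> [a|i] /=; rewrite ?mmapC ?mmapX ?mmap1U.
have [Psi [PsiC PsiX]] : exists Psi : {rmorphism {poly {mpoly K[n]}} -> {mpoly K[n.+1]}},
    (forall a, Psi a%:P = Back a) /\ Psi 'X = Y.
  exists (horner_eval Y \o map_poly Back); split=> [a|] /=.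
    by rewrite map_polyC /horner_eval hornerC.
  by rewrite map_polyX /horner_eval hornerX.
have ThXl j : Theta 'X_(lift ord_max j) = ('X_j)%:P + (c (lift ord_max j))%:MP *: 'X.
  by rewrite ThX /img liftK.
have ThXm : Theta 'X_ord_max = (c ord_max)%:MP *: 'X.
  by rewrite ThX /img unlift_none add0r.
have ThY : Theta Y = 'X.
  by rewrite rmorphM ThC ThXm mul_polyC scalerA -mpolyCM mulVf // mpolyC1 scale1r.
exists Theta, Psi; split=> //.
- apply: (rmorph_mpoly_ext (f := Psi \o Theta) (g := idfun)) => [a|i] /=.
    by rewrite ThC PsiC BackC.
  case: (unliftP ord_max i) => [j|] ->.
    by rewrite ThXl -mul_polyC rmorphD rmorphM !PsiC PsiX BackC BackX /back subrK.
  rewrite ThXm -mul_polyC rmorphM PsiC PsiX BackC /Y mulrA -mpolyCM mulfV //.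
  by rewrite mpolyC1 mul1r.
- apply: (rmorph_poly_ext (f := Theta \o Psi) (g := idfun)) => [a|] /=; last first.
    by rewrite PsiX ThY.
  rewrite PsiC; apply: (rmorph_mpoly_ext (f := Theta \o Back) (g := @polyC _)) => [b|j] /=.
    by rewrite BackC ThC.
  by rewrite BackX /back rmorphB rmorphM ThC ThXl ThY mul_polyC addrK.
Qed.

End Coordinates.

Lemma mpoly_nonroot (K : fieldType) n (f : {mpoly K[n]}) :
  [pchar K] =i pred0 -> f != 0 -> exists c : 'I_n -> K, f.@[c] != 0.
Proof.
move=> char0; elim: n f => [|n IHn] f f0.
  exists (fun=> 0); have := f0; have -> : f = (f@_0)%:MP.
    apply/mpolyP=> m; have -> : m = 0%MM by apply/mnmP => -[].
    by rewrite mcoeffC eqxx mulr1.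
  by rewrite mevalC mpolyC_eq0.
have [|Th [Psi [ThK PsiK ThC ThXl ThXm]]] := @linear_coordinates K n (fun i => (i == ord_max)%:R).
  by rewrite eqxx oner_neq0.
have Thf0 : Th f != 0 by rewrite -(rmorph0 Th) (can_eq ThK).
have [|c lc] := IHn (lead_coef (Th f)); first by rewrite lead_coef_eq0.
pose q := map_poly (meval c) (Th f).
have q0 : q != 0.
  apply: contra_neq lc => q0; rewrite lead_coefE.
  by have := congr1 (fun p : {poly K} => p`_(size (Th f)).-1) q0; rewrite coef_map coef0.
have [t qt] : exists t, ~~ root q t.
  pose rs : seq K := [seq i%:R | i <- iota 0 (size q)].
  have urs : uniq rs.
    rewrite map_inj_in_uniq ?iota_uniq // => i j _ _ ij; apply/eqP.
    wlog le_ij : i j ij / (i <= j)%N.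
      by case: (leqP i j) => [|/ltnW] ? W; [|rewrite eq_sym]; apply: W.
    have : (j - i)%:R == 0 :> K by rewrite natrB // ij subrr.
    rewrite ((pcharf0P K).1 char0) subn_eq0 => le_ji.
    by rewrite eqn_leq le_ij.
  have /allPn [t _ tq] : ~~ all (root q) rs.
    by apply/negP => /(max_poly_roots q0) /(_ urs); rewrite size_map size_iota ltnn.
  by exists t.
pose c' i := if unlift ord_max i is Some j then c j else t.
exists c'; suff -> : f.@[c'] = q.[t] by [].
apply: (rmorph_mpoly_ext (f := meval c') (g := horner_eval t \o (map_poly (meval c) \o Th))) => [a|i] /=.
  by rewrite mevalC ThC map_polyC /horner_eval /= hornerC mevalC.
rewrite mevalXU /c' /horner_eval; case: (unliftP ord_max i) => [j|] ->.
  rewrite ThXl eq_sym (negPf (neq_lift _ _)) mpolyC0 scale0r addr0.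
  by rewrite map_polyC /= hornerC mevalXU.
by rewrite ThXm eqxx mpolyC1 scale1r map_polyX hornerX.
Qed.

(** The coefficient of [f] in top degree in the new last variable is the leading
    form of [f] evaluated at [c], a constant.  The factor ['X_ord_max] makes the
    last coordinate of [c] invertible, so that the change of coordinates is one. *)
Lemma generic_unit_lead (K : fieldType) n (f : {mpoly K[n.+1]}) :
  [pchar K] =i pred0 -> f != 0 ->
  exists (Theta : {rmorphism {mpoly K[n.+1]} -> {poly {mpoly K[n]}}})
         (Psi : {rmorphism {poly {mpoly K[n]}} -> {mpoly K[n.+1]}}),
    [/\ cancel Theta Psi, cancel Psi Theta & lead_coef (Theta f) \is a GRing.unit].
Proof.
move=> char0 f0; pose d := (msize f).-1.
have dE : d.+1 = msize f by rewrite /d -mlead_deg.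
pose fd : {mpoly K[n.+1]} := \sum_(m <- msupp f | mdeg m == d) f@_m *: 'X_[m].
have fd0 : fd != 0.
  apply/eqP=> /(congr1 (mcoeff (mlead f))); rewrite mcoeff0 raddf_sum /=.
  have ml : mlead f \in msupp f by rewrite mlead_supp.
  rewrite -big_filter (bigD1_seq (mlead f)) ?filter_uniq ?msupp_uniq //=; last first.
    by rewrite mem_filter ml andbT /d -mlead_deg.
  rewrite mcoeffZ mcoeffX eqxx mulr1 big1 ?addr0 => [|m ne].
    by move/eqP; rewrite mleadc_eq0 (negPf f0).
  by rewrite mcoeffZ mcoeffX (negPf ne) mulr0.
have [|c] := @mpoly_nonroot _ _ (fd * 'X_ord_max) char0.
  by rewrite mulf_neq0 // -msupp_eq0 msuppX.
rewrite mevalM mevalXU mulf_eq0 negb_or => /andP [fdc cm].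
have [Th [Psi [ThK PsiK ThC ThXl ThXm]]] := linear_coordinates cm.
exists Th, Psi; split=> //.
(* [p] has degree at most [e], with the constant [a] as coefficient in degree [e]. *)
pose T (p : {poly {mpoly K[n]}}) e (a : K) := (size p <= e.+1)%N /\ p`_e = a%:MP.
have TM p q e e' a b : T p e a -> T q e' b -> T (p * q) (e + e')%N (a * b).
  move=> [sp pe] [sq qe]; split.
    apply: leq_trans (size_polyMleq _ _) _; rewrite -subn1 leq_subLR.
    by rewrite add1n -addSn -addnS leq_add.
  rewrite coefM (bigD1 (Ordinal (leq_addr e' e : (e < (e + e').+1)%N))) //=.
  rewrite addKn pe qe mpolyCM big1 ?addr0 // => j ne.
  have [lt_j|lt_j|eq_j] := ltngtP j e; last by case/eqP: ne; apply/val_inj.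
    rewrite [X in _ * X]nth_default ?mulr0 // (leq_trans sq) //.
    by rewrite ltn_subRL ltn_add2r.
  by rewrite nth_default ?mul0r // (leq_trans sp).
have TX m : T (Th 'X_[m]) (mdeg m) (\prod_i c i ^+ m i).
  rewrite mpolyXE_id rmorph_prod mdegE.
  elim/big_rec3: _ => [|i a e p _ Tp]; first by split; rewrite ?size_poly1 ?coef1.
  apply: (TM _ _) => //; rewrite rmorphXn.
  have TXi : T (Th 'X_i) 1 (c i).
    case: (unliftP ord_max i) => [j|] ->; rewrite ?ThXl ?ThXm.
      split; last by rewrite coefD coefC coefZ coefX mulr1 add0r.
      rewrite (leq_trans (size_polyD _ _)) // geq_max size_polyC.
      by rewrite (leq_trans (leq_b1 _)) //= (leq_trans (size_scale_leq _ _)) // size_polyX.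
    split; last by rewrite coefZ coefX mulr1.
    by rewrite (leq_trans (size_scale_leq _ _)) // size_polyX.
  elim: (m i) => [|k IHk]; first by split; rewrite ?size_poly1 ?coef1.
  by rewrite !exprS -[k.+1]add1n; apply: (TM _ _).
have lead_d : (Th f)`_d = (fd.@[c])%:MP.
  have -> : fd.@[c] = \sum_(m <- msupp f | mdeg m == d) f@_m * \prod_i c i ^+ m i.
    rewrite /fd (raddf_sum (meval c)); apply: eq_bigr => m _.
    by rewrite /= mevalZ mevalX.
  rewrite {1}[f]mpolyE rmorph_sum coef_sum (raddf_sum (@mpolyC n K)).
  rewrite [RHS]big_mkcond /=; rewrite big_seq [RHS]big_seq; apply: eq_bigr => m mf.
  have [s1 s2] := TX m; rewrite -mul_mpolyC rmorphM ThC coefCM.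
  case: eqP => [dm|/eqP dm]; first by rewrite -dm s2 mpolyCM.
  rewrite nth_default ?mulr0 // (leq_trans s1) //.
  by rewrite ltn_neqAle dm -ltnS dE msize_mdeg_lt.
have size_d : (size (Th f) <= d.+1)%N.
  rewrite {1}[f]mpolyE rmorph_sum (leq_trans (size_sum _ _ _)) //.
  apply/bigmax_leqP_seq => m mf _; rewrite -mul_mpolyC rmorphM ThC mul_polyC.
  rewrite (leq_trans (size_scale_leq _ _)) // (leq_trans (TX m).1) //.
  by rewrite dE msize_mdeg_lt.
have fdU : (fd.@[c])%:MP_[n] \is a GRing.unit by rewrite rmorph_unit ?unitfE.
have size_eq : size (Th f) = d.+1.
  apply/eqP; rewrite eqn_leq size_d ltnNge /=; apply/negP => le_d.
  by move: fdU; rewrite -lead_d nth_default // unitr0.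
by rewrite lead_coefE size_eq /= lead_d.
Qed.

(** The theorem of Quillen and Suslin, together with the existence of contents,
    which its inductive step requires. *)
Theorem mpoly_splitting (K : fieldType) n : [pchar K] =i pred0 ->
  has_contents {mpoly K[n]} /\ idempotents_split {mpoly K[n]}.
Proof.
move=> char0; elim: n => [|n [IHc IHs]].
  pose const : {rmorphism K -> {mpoly K[0]}} := @mpolyC 0 K.
  pose val : {rmorphism {mpoly K[0]} -> K} := mcoeff 0.
  have constK : cancel const val by move=> a; apply: mpolyCK.
  have valK : cancel val const.
    move=> f; apply/mpolyP=> m; have -> : m = 0%MM by apply/mnmP => -[].
    by rewrite mcoeffC eqxx mulr1.
  split; first exact: has_contents_iso constK valK (@has_contents_field K).
  exact: idempotents_split_iso valK (@idempotents_split_field K).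
have Pc := has_contents_poly IHc; split.
  have [|Th [Psi [ThK PsiK _ _ _]]] := @linear_coordinates K n (fun=> 1).
    exact: oner_neq0.
  exact: has_contents_iso PsiK ThK Pc.
move=> m E EE.
have [f [g fgE]] := mrank_minor E; have [f' [g' fgE']] := mrank_minor (1%:M - E).
have [|Th [Psi [ThK PsiK]]] := @generic_unit_lead K n
  (\det (mxsub f g E) * \det (mxsub f' g' (1%:M - E))) char0.
  exact: mulf_neq0.
rewrite rmorphM lead_coefM unitrM => /andP [u1 u2].
have mrank_Th (F : 'M[{mpoly K[n.+1]}]_m) : mrank (map_mx Th F) = mrank F.
  exact/mrank_map/(can_inj ThK).
have ThEE : map_mx Th E *m map_mx Th E = map_mx Th E by rewrite -map_mxM EE.
have Th1E : 1%:M - map_mx Th E = map_mx Th (1%:M - E) by rewrite raddfB /= map_mx1.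
have rk' : mrank (1%:M - map_mx Th E) = mrank (1%:M - E) by rewrite Th1E mrank_Th.
have [||q Eq] := idempotent_similar_poly (f := f) (g := g) (f' := f') (g' := g') IHs Pc ThEE (mrank_Th E) rk'.
- by rewrite -map_mxsub det_map_mx.
- by rewrite Th1E -map_mxsub det_map_mx.
exists q; have := similar_map Psi Eq; rewrite map_pid_mx -map_mx_comp.
suff -> : map_mx (Psi \o Th) E = E by [].
by apply/matrixP=> i j; rewrite mxE /= ThK.
Qed.

(** * Unimodular columns and reduction to square matrices *)

Section Reductions.
Variable R : idomainType.

Lemma similar_pid_mrank m (E : 'M[R]_m) r :
  similar_mx E (pid_mx r) -> similar_mx E (pid_mx (mrank E)).
Proof.
move=> [V uV EV]; suff -> : pid_mx (mrank E) = pid_mx r :> 'M[R]_m by exists V.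
have -> : mrank E = minn m r.
  have -> : mrank E = mrank (E^T) by rewrite mrank_tr.
  rewrite -(@mrank_unit _ _ _ V^T) ?unitmx_tr // -trmx_mul EV mrank_tr.
  have uV' : invmx V \in unitmx by rewrite unitmx_inv.
  rewrite -(mrank_unit _ uV') mulKmx // /mrank map_pid_mx -(pid_mx_minh _ _ m).
  by rewrite rank_pid_mx ?geq_minl.
exact: pid_mx_minh.
Qed.

Hypothesis Rs : idempotents_split R.

(** The matrix [w *m u] is idempotent of rank 1, and similar to a diagonal one. *)
Lemma complete_unimodular_column m (w : 'cV[R]_(1 + m)) (u : 'rV[R]_(1 + m)) :
  u *m w = 1%:M -> exists2 U, U \in unitmx & U *m w = col_mx 1%:M 0.
Proof.
move=> uw; pose E := w *m u.
have Ew : E *m w = w by rewrite -mulmxA uw mulmx1.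
have EE : E *m E = E by rewrite {2}/E mulmxA Ew.
have rE : mrank E = 1%N.
  apply/eqP; rewrite eqn_leq; apply/andP; split.
    by apply: leq_trans (mrank_mul_le_l _ _) (rank_leq_col _).
  have r1 : mrank (u *m w) = 1%N by rewrite uw /mrank map_mx1 mxrank1.
  rewrite -[X in (X <= _)%N]r1 -Ew; apply: leq_trans (mrank_mul_le_r _ _) (mrank_mul_le_l _ _).
have [r /similar_pid_mrank] := Rs EE; rewrite rE => -[V uV EV].
pose x := invmx V *m w; pose y := u *m V.
have xE : x = pid_mx 1 *m x.
  have VE : pid_mx 1 *m invmx V = invmx V *m E.
    by rewrite -[E in RHS](mulmxK uV) EV !mulmxA mulVmx // mul1mx.
  by rewrite /x (mulmxA (pid_mx 1)) VE -(mulmxA _ E) Ew.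
have yx : y *m x = 1%:M by rewrite -mulmxA mulKVmx.
have xE' : x = col_mx (usubmx x) 0.
  rewrite {1}xE -[x in LHS]vsubmxK (@pid_mx_block _ m m 1) mul_block_col.
  by rewrite !mul0mx !addr0 mul1mx.
pose a := usubmx x 0 0.
have ua : a \is a GRing.unit.
  apply/unitrPr; exists (lsubmx y 0 0); rewrite mulrC.
  have : row_mx (lsubmx y) (rsubmx y) *m x = 1%:M by rewrite hsubmxK.
  rewrite xE' mul_row_col mulmx0 addr0 => /matrixP/(_ 0 0).
  by rewrite [LHS]mxE [RHS]mxE big_ord1 eqxx.
exists (a^-1 *: invmx V).
  by rewrite unitmxZ ?unitmx_inv // unitrV.
rewrite -scalemxAl -/x xE' scale_col_mx scaler0; congr col_mx.
apply/matrixP=> i j; rewrite !ord1 [LHS]mxE -/a mulVr // mxE eqxx //.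
Qed.

(** Cramer's rule: the entries of [\adj N *m C] are determinants of [N] with one
    column replaced by a column of [C]. *)
Lemma adj_mul_rowsub l m r (F : 'M[R]_(l, m)) (f : 'I_r -> 'I_l) (g : 'I_r -> 'I_m) b q :
  (\adj (mxsub f g F) *m rowsub f F) b q =
  \det (mxsub f (fun j => if j == b then q else g j) F).
Proof.
rewrite mxE (expand_det_col _ b); apply: eq_bigr => a _.
rewrite !mxE eqxx mulrC; congr (_ * _); rewrite /cofactor; congr (_ * \det _).
by apply/matrixP=> i j; rewrite !mxE eq_sym (negPf (neq_lift _ _)).
Qed.

(** Over the fraction field, [F = Z *m N *m Z'], where [N] is the given
    submatrix, because [F] has the rank of [N]. *)
Lemma mul_minor_adj l m r (F : 'M[R]_(l, m)) (f : 'I_r -> 'I_l) (g : 'I_r -> 'I_m) :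
  mrank F = r -> \det (mxsub f g F) != 0 ->
  F *m (colsub g 1%:M *m \adj (mxsub f g F) *m rowsub f 1%:M) *m F =
  \det (mxsub f g F) *: F.
Proof.
move=> rF; set N := mxsub f g F => N0.
pose fr n1 n2 (X : 'M[R]_(n1, n2)) := map_mx (@tofrac R) X.
have uN : fr _ _ N \in unitmx by rewrite unitmxE unitfE det_map_mx tofrac_eq0.
have rN : \rank (fr _ _ N) = r by apply: mxrank_unit.
have NF : fr _ _ N = rowsub f 1%:M *m fr _ _ F *m colsub g 1%:M.
  rewrite mul_rowsub_mx mul1mx mulmx_colsub mulmx1.
  by apply/matrixP=> i j; rewrite !mxE.
have [Z ZE] : exists Z, fr _ _ F = Z *m (rowsub f 1%:M *m fr _ _ F).
  apply/submxP; have sub : (rowsub f 1%:M *m fr _ _ F <= fr _ _ F)%MS by apply: submxMl.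
  rewrite -(geq_leqif (mxrank_leqif_sup sub)) [\rank (fr _ _ F)]rF.
  by rewrite -[X in (X <= _)%N]rN NF mxrankM_maxl.
have [Z' Z'E] : exists Z', fr _ _ F = (fr _ _ F *m colsub g 1%:M) *m Z'.
  suff [Z' Z'E] : exists Z', (fr _ _ F)^T = Z' *m (fr _ _ F *m colsub g 1%:M)^T.
    by exists Z'^T; apply: trmx_inj; rewrite trmx_mul trmxK.
  apply/submxP; have sub : ((fr _ _ F *m colsub g 1%:M)^T <= (fr _ _ F)^T)%MS.
    by rewrite trmx_mul; apply: submxMl.
  rewrite -(geq_leqif (mxrank_leqif_sup sub)) !mxrank_tr [\rank (fr _ _ F)]rF.
  by rewrite -[X in (X <= _)%N]rN NF -mulmxA mxrankM_maxr.
have FE : fr _ _ F = Z *m fr _ _ N *m Z'.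
  by rewrite {1}ZE {1}Z'E NF !mulmxA.
have ZN : fr _ _ F *m colsub g 1%:M = Z *m fr _ _ N.
  by rewrite {1}ZE NF !mulmxA.
have NZ : rowsub f 1%:M *m fr _ _ F = fr _ _ N *m Z'.
  by rewrite {1}Z'E NF !mulmxA.
have colE : map_mx (@tofrac R) (colsub g 1%:M) = colsub g 1%:M.
  by apply/matrixP=> i j; rewrite !mxE rmorph_nat.
have rowE : map_mx (@tofrac R) (rowsub f 1%:M) = rowsub f 1%:M.
  by apply/matrixP=> i j; rewrite !mxE rmorph_nat.
apply: map_tofrac_inj; rewrite /= map_mxZ !map_mxM colE rowE map_mx_adj.
rewrite -!/(fr _ _ _) -det_map_mx -/(fr _ _ N).
rewrite !mulmxA ZN -(mulmxA _ (rowsub f _)) NZ -(mulmxA Z) mul_mx_adj.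
by rewrite mul_mx_scalar -scalemxAl mulmxA -FE.
Qed.

(** By [mul_minor_adj] and Cramer's rule, the [y] for which some [A] satisfies
    [F *m A *m F = y *: F], with [A *m F] divisible by [d], form an ideal that
    contains all the [r]-minors, hence [d].  The quotient [E] of [A *m F] by [d]
    is then an idempotent matrix with the same kernel as [F], and it is similar
    to a diagonal one. *)
Lemma column_reduction l m (F : 'M[R]_(l, m)) r d :
  mrank F = r -> minor_ideal F r d -> d != 0 ->
  exists (V : 'M[R]_m) (F1 : 'M[R]_(l, r)), V \in unitmx /\ F *m V = F1 *m pid_mx r.
Proof.
move=> rF Fd d0.
pose J (y : R) := exists (A : 'M[R]_(m, l)) (E : 'M[R]_m),
  F *m A *m F = y *: F /\ A *m F = d *: E.
have idJ : is_ideal J.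
  split.
  - by exists 0, 0; rewrite mulmx0 mul0mx !scaler0 scale0r mul0mx.
  - move=> x y [A [E [FAF AF]]] [B [E' [FBF BF]]]; exists (A + B), (E + E').
    by rewrite mulmxDr !mulmxDl FAF FBF AF BF scalerDl scalerDr.
  - move=> c x [A [E [FAF AF]]]; exists (c *: A), (c *: E).
    by rewrite -scalemxAr -!scalemxAl FAF AF !scalerA [c * d]mulrC.
have [A [E [FAF AF]]] : J d.
  apply/(Fd _ idJ) => f g; have [->|N0] := eqVneq (\det (mxsub f g F)) 0.
    exact: ideal0.
  have Yex b q : exists x, (\adj (mxsub f g F) *m rowsub f F) b q == d * x.
    rewrite adj_mul_rowsub.
    have [x ->] := minor_ideal_minor f (fun j => if j == b then q else g j) Fd.
    by exists x; rewrite mulrC.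
  pose Y := \matrix_(b, q) xchoose (Yex b q).
  have YE : \adj (mxsub f g F) *m rowsub f F = d *: Y.
    by apply/matrixP=> b q; rewrite [RHS]mxE [Y b q]mxE; apply/eqP/(xchooseP (Yex b q)).
  exists (colsub g 1%:M *m \adj (mxsub f g F) *m rowsub f 1%:M), (colsub g 1%:M *m Y).
  split; first exact: mul_minor_adj.
  by rewrite -!mulmxA mul_rowsub_mx mul1mx YE scalemxAr.
have FE : F *m E = F by apply: (scalemx_inj d0) => /=; rewrite scalemxAr -AF mulmxA.
have EE : E *m E = E.
  by apply: (scalemx_inj d0) => /=; rewrite scalemxAl -AF -mulmxA FE.
have rE : mrank E = r.
  apply/eqP; rewrite eqn_leq -rF -{2}FE mrank_mul_le_r andbT.
  have <- : mrank (d *: E) = mrank E.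
    by rewrite /mrank map_mxZ mxrank_scale_nz // tofrac_eq0.
  by rewrite -AF mrank_mul_le_r.
have [q /similar_pid_mrank] := Rs EE; rewrite rE => -[V uV EV].
exists V, (F *m V *m pid_mx r); split=> //.
have le_r : (r <= m)%N by rewrite -rF; apply: rank_leq_col.
rewrite -mulmxA mul_pid_mx minnn (minn_idPr (leqnn r)).
by rewrite -{1}FE -!mulmxA EV.
Qed.

Lemma square_reduction l m (F : 'M[R]_(l, m)) r d :
  mrank F = r -> minor_ideal F r d -> d != 0 ->
  exists (U : 'M[R]_l) (V : 'M[R]_m) (F0 : 'M[R]_r),
    [/\ U \in unitmx, V \in unitmx & U *m F *m V = pid_mx r *m F0 *m pid_mx r].
Proof.
move=> rF Fd d0; have [V [F1 [uV FV]]] := column_reduction rF Fd d0.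
have le_r : (r <= m)%N by rewrite -rF; apply: rank_leq_col.
have FE : F = 1%:M *m F1 *m (pid_mx r *m invmx V).
  by rewrite mul1mx mulmxA -FV mulmxK.
have F1E : F1 = 1%:M *m F *m (V *m pid_mx r).
  rewrite mul1mx mulmxA FV -mulmxA mul_pid_mx minnn (minn_idPr le_r).
  by rewrite pid_mx_1 mulmx1.
have rF1 : mrank F1 = r.
  apply/eqP; rewrite eqn_leq rank_leq_col /= -{1}rF {1}FE mul1mx.
  exact: mrank_mul_le_l.
have F1d : minor_ideal F1^T r d.
  by apply: minor_ideal_tr; apply: minor_ideal_mul Fd; [exact: F1E | exact: FE].
have rF1t : mrank F1^T = r by rewrite mrank_tr.
have [W [F2 [uW F1W]]] := column_reduction rF1t F1d d0.
exists W^T, V, F2^T; split; rewrite ?unitmx_tr //.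
rewrite -mulmxA FV mulmxA; congr (_ *m _); apply: trmx_inj.
by rewrite !trmx_mul !trmxK tr_pid_mx F1W.
Qed.

End Reductions.

(** * Monomial systems *)

(** What the argument uses of coordinates [x_1, .., x_n]: their monomials, and
    the retractions [kill j] that set [x_j] to zero.  These properties hold for
    the images of the variables under any automorphism of a polynomial ring. *)
Record monomial_system (R : idomainType) n (mono : 'X_{1..n} -> R)
    (kill : 'I_n -> {rmorphism R -> R}) : Prop := MonomialSystem {
  mono0 : mono 0%MM = 1;
  monoD : forall u v, mono (u + v)%MM = mono u * mono v;
  mono_neq0 : forall u, mono u != 0;
  mono_divides : forall u v q, mono v = q * mono u -> (u <= v)%MM;
  kill_mono : forall j u, kill j (mono u) = if u j == 0%N then mono u else 0;
  kill_split : forall j p, exists q, p = kill j p + mono U_(j)%MM * q;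
  kill_comm : forall i j p, kill i (kill j p) = kill j (kill i p)
}.

Lemma mnm_neq0_var n (u : 'X_{1..n}) : u != 0%MM -> exists j, u j != 0%N.
Proof.
move=> u0; apply/existsP; apply: contraNT u0 => /existsPn u0.
by apply/eqP/mnmP => i; rewrite mnm0E; apply/eqP/negPn.
Qed.

Section MonomialMinors.
Variables (R : idomainType) (n : nat) (mono : 'X_{1..n} -> R).
Variables (kill : 'I_n -> {rmorphism R -> R}) (monoS : monomial_system mono kill).
Implicit Types (D : nat -> 'X_{1..n}).

Lemma monoXn u i : mono u ^+ i = mono (u *+ i)%MM.
Proof.
elim: i => [|i IHi]; first by rewrite expr0 mulm0n (mono0 monoS).
by rewrite mulmS (monoD monoS) -IHi exprS.
Qed.

(** [D i] is the exponent of the gcd of the [i]-minors; the invariant factors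
    have the exponents [quotient_exp D]. *)
Definition monomial_minors l m (F : 'M[R]_(l, m)) r D :=
  [/\ D 0%N = 0%MM, mrank F = r & forall i, (i <= r)%N -> minor_ideal F i (mono (D i))].

Definition active_vars r D := [set j : 'I_n | D r j != 0%N].

Definition quotient_exp D (a : nat) : 'X_{1..n} := (D a.+1 - D a)%MM.

Definition diag_monomials l m r (e : nat -> 'X_{1..n}) : 'M[R]_(l, m) :=
  \matrix_(i, j) (if ((i : nat) == j) && (i < r)%N then mono (e i) else 0).

(** Each invariant factor divides the next one. *)
Definition convex_upto r D :=
  forall a j, (a.+2 <= r)%N -> (D a.+1 j + D a.+1 j <= D a j + D a.+2 j)%N.

(** Convexity is part of the conclusion, not of the hypotheses: to bring the
    restrictions of a matrix to Smith form one after the other, one has to know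
    the convexity of their exponents. *)
Definition monomial_smith l m (F : 'M[R]_(l, m)) r D :=
  convex_upto r D /\
  exists (U : 'M[R]_l) (V : 'M[R]_m), [/\ U \in unitmx, V \in unitmx &
    U *m F *m V = diag_monomials l m r (quotient_exp D)].

Lemma monomial_minors_le l m (F : 'M[R]_(l, m)) r D : monomial_minors F r D ->
  forall a b j, (a <= b)%N -> (b <= r)%N -> (D a j <= D b j)%N.
Proof.
move=> [_ _ Fd] a b j; elim: b => [|b IHb].
  by rewrite leqn0 => /eqP ->.
rewrite leq_eqVlt => /predU1P [->|] //; rewrite ltnS => ab br.
apply: leq_trans (IHb ab (ltnW br)) _.
have [q /(mono_divides monoS)/mnm_lepP] := minor_ideal_dvd (Fd _ (ltnW br)) (Fd _ br).
exact.
Qed.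

(** Setting [x_j] to zero keeps the gcds of the minors that [x_j] does not
    divide, and makes the next one vanish. *)
Lemma monomial_minors_kill l m (F : 'M[R]_(l, m)) r D r' j :
  monomial_minors F r D -> (r' < r)%N -> D r' j = 0%N -> D r'.+1 j != 0%N ->
  monomial_minors (map_mx (kill j) F) r' D.
Proof.
move=> MF lt_r Dr' Dr'1; have Dle := monomial_minors_le MF; have [D0 _ Fd] := MF.
have Fk i : (i <= r')%N -> minor_ideal (map_mx (kill j) F) i (mono (D i)).
  move=> le_i; have := minor_ideal_map (kill j) (Fd i (leq_trans le_i (ltnW lt_r))).
  rewrite (kill_mono monoS); case: eqP => //.
  by have := Dle _ _ j le_i (ltnW lt_r); rewrite Dr' leqn0 => /eqP ->.
split=> //; apply: minor_ideal_mrank (mono_neq0 monoS _) (Fk _ (leqnn _)) _.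
by have := minor_ideal_map (kill j) (Fd _ lt_r); rewrite (kill_mono monoS) (negPf Dr'1).
Qed.

Lemma monomial_minors_factor l m (F : 'M[R]_(l, m)) r D : monomial_minors F r.+1 D ->
  exists F' D', [/\ F = mono (D 1%N) *: F', monomial_minors F' r.+1 D', D' 1%N = 0%MM &
    forall i, (i <= r.+1)%N -> D i = (D 1%N *+ i + D' i)%MM].
Proof.
move=> [D0 rF Fd]; pose D' i := (D i - D 1%N *+ i)%MM.
have Fex i j : exists q, F i j == mono (D 1%N) * q.
  have [q] := minor_ideal_minor (fun _ : 'I_1 => i) (fun _ : 'I_1 => j) (Fd 1%N isT).
  by rewrite det_mx11 mxE => ->; exists q; rewrite mulrC.
exists (\matrix_(i, j) xchoose (Fex i j)), D'; set F' := \matrix_(i, j) _.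
have FE : F = mono (D 1%N) *: F'.
  by apply/matrixP=> i j; rewrite [RHS]mxE [F' i j]mxE; apply/eqP/(xchooseP (Fex i j)).
have DE i : (i <= r.+1)%N -> D i = (D 1%N *+ i + D' i)%MM.
  move=> le_i; have idJ := multiples_ideal (mono (D 1%N) ^+ i : R).
  have [q qE] : exists q, mono (D i) = q * mono (D 1%N) ^+ i.
    apply/(Fd i le_i _ idJ) => f g; rewrite FE det_mxsub_scale.
    by exists (\det (mxsub f g F')); rewrite mulrC.
  by rewrite /D' addmC submK //; apply: (@mono_divides _ _ _ _ monoS _ _ q); rewrite -monoXn.
split=> //; last by apply/mnmP => j; rewrite /D' mnmBE mulm1n subnn mnm0E.
split; first by rewrite /D' D0; apply/mnmP => j; rewrite mnmBE !mnm0E.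
  by rewrite -rF FE /mrank map_mxZ mxrank_scale_nz // tofrac_eq0 (mono_neq0 monoS).
move=> i le_i; apply: (minor_idealZ (a := mono (D 1%N))); first exact: (mono_neq0 monoS).
by rewrite -FE monoXn -(monoD monoS) -DE //; apply: Fd.
Qed.

(** By convexity, [x_j] divides all the invariant factors from index [r] on. *)
Lemma kill_diag_monomials l m r r' D j :
  (forall a b, (a <= b)%N -> (b <= r')%N -> (D a j <= D b j)%N) ->
  convex_upto r' D -> (r <= r')%N -> D r j = 0%N -> D r.+1 j != 0%N ->
  map_mx (kill j) (diag_monomials l m r' (quotient_exp D)) =
  diag_monomials l m r (quotient_exp D).
Proof.
move=> Dle Dconv le_r Dr Dr1; apply/matrixP=> x y; rewrite !mxE.
case: eqP => [_|_] /=; last by rewrite rmorph0.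
have [lt_x|le_x] := ltnP x r.
  rewrite (leq_trans lt_x) // (kill_mono monoS) /quotient_exp mnmBE.
  have := Dle x.+1 r lt_x le_r; rewrite Dr leqn0 => /eqP ->.
  by rewrite sub0n.
case: ltnP => lt_x; last by rewrite rmorph0.
rewrite (kill_mono monoS) mnmBE; suff: (D x j < D x.+1 j)%N by rewrite -subn_gt0 lt0n => /negPf ->.
have [a xE] : exists a, val x = (r + a)%N by exists (x - r)%N; rewrite subnKC.
rewrite /= xE in le_x lt_x *; elim: a {xE} le_x lt_x => [|a IHa] le_x lt_x.
  by rewrite addn0 Dr lt0n.
have := Dconv (r + a)%N j; rewrite -addnS => /(_ lt_x).
have := IHa (leq_addr _ _) (ltnW _); rewrite addnS in lt_x *.
move=> /(_ lt_x); rewrite -!addnS => H1 H2.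
move: H1 H2; rewrite !addnS; lia.
Qed.

Lemma kill_diag_monomials_id l m r D j :
  (forall a b, (a <= b)%N -> (b <= r)%N -> (D a j <= D b j)%N) -> D r j = 0%N ->
  map_mx (kill j) (diag_monomials l m r (quotient_exp D)) =
  diag_monomials l m r (quotient_exp D).
Proof.
move=> Dle Dr; apply/matrixP=> x y; rewrite !mxE.
case: eqP => [_|_] /=; last by rewrite rmorph0.
case: ltnP => lt_x; last by rewrite rmorph0.
rewrite (kill_mono monoS) mnmBE; have := Dle x.+1 r lt_x (leqnn _); rewrite Dr leqn0 => /eqP ->.
by rewrite sub0n.
Qed.

End MonomialMinors.

(** * Smith forms with monomial invariant factors *)

Section MonomialSmith.
Variables (R : idomainType) (n : nat) (mono : 'X_{1..n} -> R).
Variables (kill : 'I_n -> {rmorphism R -> R}) (monoS : monomial_system mono kill).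
Notation monomial_minors := (monomial_minors mono).
Notation monomial_smith := (monomial_smith mono).
Notation diag_monomials := (diag_monomials mono).
Implicit Types (D : nat -> 'X_{1..n}).
Hypothesis Rs : idempotents_split R.

(** The induction hypothesis, for the number of coordinates that divide the gcd
    of the [r]-minors. *)
Definition smith_below N := forall l m (F : 'M[R]_(l, m)) r D,
  monomial_minors F r D -> (#|active_vars r D| < N)%N -> monomial_smith F r D.

Lemma monomial_minors_equiv l m (F : 'M[R]_(l, m)) r D U V :
  U \in unitmx -> V \in unitmx -> monomial_minors F r D ->
  monomial_minors (U *m F *m V) r D.
Proof.
move=> uU uV [D0 rF Fd]; split=> // [|i le_i]; first by rewrite mrank_mul_unit.
by apply: minor_ideal_equiv => //; apply: Fd.
Qed.

Lemma monomial_smith_equiv l m (F : 'M[R]_(l, m)) r D U V :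
  U \in unitmx -> V \in unitmx -> monomial_smith (U *m F *m V) r D ->
  monomial_smith F r D.
Proof.
move=> uU uV [Dconv [U' [V' [uU' uV' E]]]]; split=> //.
exists (U' *m U), (V *m V'); rewrite !unitmx_mul uU uU' uV uV'; split=> //.
by rewrite -E !mulmxA.
Qed.

(** Here [rk j] is the rank of [F] where [x_j = 0], and its Smith form there is
    the diagonal matrix of the first [rk j] invariant factors.  Suppose that the
    restriction to [x_i = 0] is already in Smith form, with [rk i <= rk j], and
    that [U2] and [V2], which do not involve [x_j], reduce the restriction to
    [x_j = 0].  Setting [x_i] to zero in this reduction shows that [U2] and [V2]
    fix the Smith form for [x_i]: its entries do not involve [x_j], and it is
    also what the Smith form for [x_j] becomes when [x_i = 0]. *)
Lemma glue_restrictions N l m (F : 'M[R]_(l, m)) r D (rk : 'I_n -> nat) js :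
  smith_below N -> monomial_minors F r D -> (#|active_vars r D| <= N)%N ->
  (forall j, j \in js -> [/\ (rk j < r)%N, D (rk j) j = 0%N & D (rk j).+1 j != 0%N]) ->
  pairwise (fun i j => (rk i <= rk j)%N) js ->
  exists (U : 'M[R]_l) (V : 'M[R]_m), [/\ U \in unitmx, V \in unitmx &
    forall j, j \in js -> map_mx (kill j) (U *m F *m V) =
                          diag_monomials l m (rk j) (quotient_exp D)].
Proof.
move=> below MF leN; elim/last_ind: js => [|js j IHjs] rkP.
  by exists 1%:M, 1%:M; rewrite !unitmx1.
rewrite pairwise_rcons => /andP [/allP rk_le pw].
have [i ijs||U [V [uU uV UV]]] // := IHjs.
  by apply: rkP; rewrite mem_rcons inE ijs orbT.
have [lt_r Dr Dr1] : [/\ (rk j < r)%N, D (rk j) j = 0%N & D (rk j).+1 j != 0%N].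
  by apply: rkP; rewrite mem_rcons mem_head.
have MG := monomial_minors_equiv uU uV MF.
suff [U2 [V2 [uU2 uV2 UV2]]] : exists (U2 : 'M[R]_l) (V2 : 'M[R]_m),
    [/\ U2 \in unitmx, V2 \in unitmx & forall i, i \in rcons js j ->
      map_mx (kill i) (U2 *m (U *m F *m V) *m V2) =
      diag_monomials l m (rk i) (quotient_exp D)].
  exists (U2 *m U), (V *m V2); rewrite !unitmx_mul uU uV uU2 uV2; split=> // i ijs.
  by rewrite -UV2 // !mulmxA.
move: (U *m F *m V) UV MG => G UV MG {F MF U V uU uV IHjs}.
have Dle := monomial_minors_le monoS MG.
have lt_N : (#|active_vars (rk j) D| < N)%N.
  apply: leq_trans leN; apply: proper_card; apply/properP; split.
    apply/subsetP => i; rewrite !inE -!lt0n => /leq_trans; apply.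
    exact: Dle (ltnW lt_r) (leqnn _).
  exists j; rewrite !inE ?Dr // -lt0n; rewrite -lt0n in Dr1.
  exact: leq_trans Dr1 (Dle _ _ _ lt_r (leqnn _)).
have [Dconv [U1 [V1 [uU1 uV1 UV1]]]] := below _ _ _ _ _ (monomial_minors_kill monoS MG lt_r Dr Dr1) lt_N.
have Dle_j a b i : (a <= b)%N -> (b <= rk j)%N -> (D a i <= D b i)%N.
  by move=> ab bj; apply: Dle => //; apply: leq_trans bj (ltnW lt_r).
(* Removing [x_j] from [U1] and [V1] does not change what they do on [x_j = 0]. *)
pose U2 := map_mx (kill j) U1; pose V2 := map_mx (kill j) V1.
have kill_idem p : kill j (kill j p) = kill j p.
  have [q /(congr1 (kill j)) pE] := kill_split monoS j p.
  by rewrite rmorphD rmorphM (kill_mono monoS) mnm1E eqxx mul0r addr0 in pE.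
have unit_map i s (M : 'M[R]_s) : M \in unitmx -> map_mx (kill i) M \in unitmx.
  by rewrite !unitmxE det_map_mx; apply: rmorph_unit.
exists U2, V2; rewrite !unit_map //; split=> // i.
rewrite mem_rcons inE => /predU1P [->|ijs].
  rewrite !map_mxM; have -> : map_mx (kill j) U2 = U2.
    by apply/matrixP=> x y; rewrite !mxE kill_idem.
  have -> : map_mx (kill j) V2 = V2.
    by apply/matrixP=> x y; rewrite !mxE kill_idem.
  have <- : map_mx (kill j) (map_mx (kill j) G) = map_mx (kill j) G.
    by apply/matrixP=> x y; rewrite !mxE kill_idem.
  by rewrite -!map_mxM UV1 (kill_diag_monomials_id monoS _ _ (fun a b => @Dle_j a b j)).
have [lt_i Di Di1] : [/\ (rk i < r)%N, D (rk i) i = 0%N & D (rk i).+1 i != 0%N].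
  by apply: rkP; rewrite mem_rcons inE ijs orbT.
have le_ij := rk_le _ ijs.
have Dij : D (rk i) j = 0%N.
  by have := Dle_j _ _ j le_ij (leqnn _); rewrite Dr leqn0 => /eqP.
have comm s t (M : 'M[R]_(s, t)) :
    map_mx (kill i) (map_mx (kill j) M) = map_mx (kill j) (map_mx (kill i) M).
  by apply/matrixP=> x y; rewrite !mxE (kill_comm monoS).
have Dle_i a b : (a <= b)%N -> (b <= rk i)%N -> (D a j <= D b j)%N.
  by move=> le_ab le_b; apply: Dle => //; apply: leq_trans le_b (ltnW lt_i).
have Si := kill_diag_monomials_id monoS l m Dle_i Dij.
have := congr1 (map_mx (kill i)) UV1; rewrite !map_mxM comm UV // Si.
rewrite (kill_diag_monomials monoS l m (fun a b => @Dle_j a b i) Dconv le_ij Di Di1).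
by move/(congr1 (map_mx (kill j))); rewrite !map_mxM -!comm Si.
Qed.

(** Modulo [J], each [x_j] that divides the monomial is invertible, and so is the
    monomial. *)
Lemma monomial_unit_ideal (J : R -> Prop) (d : 'X_{1..n}) : is_ideal J ->
  (forall j, d j != 0%N -> exists f, J (1 + mono U_(j)%MM * f)) -> J (mono d) -> J 1.
Proof.
move=> idJ; have [N] := ubnP (mdeg d); elim: N d => // N IH d; rewrite ltnS => leN Jd JX.
have [d0|d0] := eqVneq d 0%MM; first by move: JX; rewrite d0 (mono0 monoS).
have [j dj] := mnm_neq0_var d0.
have le_d : (U_(j) <= d)%MM by rewrite lep1mP.
apply: (IH (d - U_(j))%MM).
- apply: leq_trans leN; have := congr1 mdeg (submK le_d).
  by rewrite mdegD mdeg1 addn1 => <-.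
- move=> i; rewrite mnmBE => di; apply: Jd.
  by apply: contra_neq di => ->.
have [f Jf] := Jd j dj.
have -> : mono (d - U_(j))%MM = mono (d - U_(j))%MM * (1 + mono U_(j)%MM * f) - f * mono d.
  have -> : mono d = mono (d - U_(j))%MM * mono U_(j)%MM by rewrite -(monoD monoS) submK.
  by ring.
by apply: idealB => //; apply: idealMl.
Qed.

(** The ideal of the entries of the first column contains [\det G], by the
    adjugate, hence the last monomial; and modulo each coordinate that divides
    this monomial, the top entry is [1]. *)
Lemma unimodular_first_column r (G : 'M[R]_(1 + r)) D :
  monomial_minors G (1 + r) D ->
  (forall j, j \in active_vars (1 + r) D -> kill j (G 0 0) = 1) ->
  exists u, u *m col 0 G = 1%:M.
Proof.
move=> [_ _ Gd] G00; pose J (y : R) := exists u, u *m col 0 G = y%:M.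
have idJ : is_ideal J.
  split; first by exists 0; rewrite mul0mx raddf0.
    by move=> x y [u uE] [v vE]; exists (u + v); rewrite mulmxDl uE vE raddfD.
  by move=> a x [u uE]; exists (a *: u); rewrite -scalemxAl uE scale_scalar_mx.
have J_row (X : 'rV[R]_(1 + r)) : J ((X *m G) 0 0).
  exists X; apply/matrixP=> i j; rewrite !ord1 !mxE eqxx mulr1n.
  by apply: eq_bigr => k _; rewrite mxE.
suff : J 1 by [].
apply: (@monomial_unit_ideal J (D (1 + r)%N)) => //.
  move=> j Dj; have [q GE] := kill_split monoS j (G 0 0).
  rewrite G00 ?inE // in GE; exists q; rewrite -GE.
  by have := J_row (delta_mx 0 0); rewrite -rowE mxE.
have Jdet : J (\det G).
  have := J_row (row 0 (\adj G)); rewrite -row_mul mul_adj_mx.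
  by rewrite mxE [_%:M _ _]mxE eqxx mulr1n.
by apply/(Gd _ (leqnn _) _ idJ) => f g; have [q ->] := det_sub_sq G f g; apply: idealMl.
Qed.

(** The matrix is divided by its first invariant factor, its restrictions to the
    coordinate hyperplanes are brought to Smith form, and its first column,
    which has become unimodular, is completed into an invertible matrix. *)
Lemma square_monomial_smith N r (F : 'M[R]_r) D :
  smith_below N -> monomial_minors F r D -> (#|active_vars r D| <= N)%N ->
  monomial_smith F r D.
Proof.
move=> below; elim: r F D => [|r IHr] F D MF leN.
  split=> //; exists 1%:M, 1%:M; rewrite !unitmx1; split=> //.
  by apply/matrixP=> -[].
have [F' [D' [FE MF' D'1 DE]]] := monomial_minors_factor monoS MF.
have D'le := monomial_minors_le monoS MF'.
have leN' : (#|active_vars r.+1 D'| <= N)%N.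
  apply: leq_trans leN; apply: subset_leq_card; apply/subsetP => j.
  rewrite !inE DE // mnmDE; apply: contraNneq => /eqP.
  by rewrite addn_eq0 => /andP [].
suff [D'conv [U [V [uU uV UV]]]] : monomial_smith F' r.+1 D'.
  split.
    move=> a j le_a; have := D'conv a j le_a.
    rewrite (DE a) ?(DE a.+1) ?(DE a.+2) ?(ltnW le_a) ?(ltnW (ltnW le_a)) //.
    rewrite !mnmDE !mulmnE !mulnS; lia.
  exists U, V; split=> //; rewrite FE -scalemxAr -scalemxAl UV.
  apply/matrixP=> i j; rewrite !mxE; case: ifP => [/andP [_ lt_i]|]; last by rewrite mulr0.
  rewrite -(monoD monoS); congr (mono _); apply/mnmP => k.
  rewrite /quotient_exp mnmDE !mnmBE (DE i) ?(ltnW lt_i) // (DE i.+1) // !mnmDE !mulmnE mulnS.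
  have := D'le i i.+1 k (leqnSn _) lt_i.
  lia.
(* As [D'] increases, [rk j] counts the [i >= 1] such that [x_j] does not divide
   the gcd of the [i]-minors. *)
pose rk (j : 'I_n) := find (fun a => D' a.+1 j != 0%N) (iota 0 r.+1).
have rkP j : j \in active_vars r.+1 D' ->
    [/\ (rk j < r.+1)%N, D' (rk j) j = 0%N & D' (rk j).+1 j != 0%N].
  rewrite inE => Dj.
  have has_j : has (fun a => D' a.+1 j != 0%N) (iota 0 r.+1).
    by apply/hasP; exists r => //; rewrite mem_iota /= add0n ltnSn.
  have lt_rk : (rk j < r.+1)%N by rewrite -[X in (_ < X)%N](size_iota 0) -has_find.
  split=> //; last by have := nth_find 0%N has_j; rewrite -/(rk j) nth_iota.
  case rkj: (rk j) => [|a]; first by case: MF' => -> _ _; rewrite mnm0E.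
  have lt_a : (a < rk j)%N by rewrite rkj.
  have := before_find 0%N lt_a; rewrite nth_iota ?add0n; first by move/negPn/eqP.
  exact: ltn_trans lt_a lt_rk.
pose js := sort (fun i j => (rk i <= rk j)%N) (enum (active_vars r.+1 D')).
have js_act j : (j \in js) = (j \in active_vars r.+1 D').
  by rewrite mem_sort mem_enum.
have js_rk j : j \in js -> [/\ (rk j < r.+1)%N, D' (rk j) j = 0%N & D' (rk j).+1 j != 0%N].
  by rewrite js_act; apply: rkP.
have js_sorted : pairwise (fun i j => (rk i <= rk j)%N) js.
  rewrite -sorted_pairwise => [|x y z]; last exact: leq_trans.
  by apply: sort_sorted => x y; apply: leq_total.
have [U [V [uU uV UV]]] := glue_restrictions below MF' leN' js_rk js_sorted.
apply: (monomial_smith_equiv uU uV).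
have MG := monomial_minors_equiv uU uV MF'.
move: (U *m F' *m V) UV MG => G UV MG {F FE F' MF' MF U V uU uV}.
rewrite -[r.+1]/(1 + r)%N in G UV MG D'le rkP leN' *.
(* The first invariant factor is [1], so it survives in all the restrictions. *)
have kG j : j \in active_vars (1 + r) D' -> kill j (G 0 0) = 1.
  move=> jact; have [_ _ Dr1] := rkP j jact.
  have jjs : j \in js by rewrite js_act.
  have /matrixP/(_ 0 0) := UV j jjs; rewrite !mxE /= => ->; rewrite lt0n ifT.
    rewrite /quotient_exp D'1; case: MG => -> _ _.
    suff -> : (0 - 0)%MM = 0%MM :> 'X_{1..n} by rewrite (mono0 monoS).
    by apply/mnmP => i; rewrite mnmBE mnm0E.
  by apply: contra_neq Dr1 => ->; rewrite D'1 mnm0E.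
have [u uG] := unimodular_first_column MG kG.
have [U uU UG] := complete_unimodular_column Rs uG.
have G0 : lsubmx G = col 0 G.
  by apply/matrixP=> i j; rewrite !mxE ord1; congr (G _ _); apply/val_inj.
pose b := usubmx (rsubmx (U *m G)); pose F2 := dsubmx (rsubmx (U *m G)).
have UGE : U *m G = block_mx 1%:M b 0 F2.
  by rewrite -[LHS]hsubmxK -mulmx_lsub G0 UG block_mxEh vsubmxK.
pose V : 'M[R]_(1 + r) := block_mx 1%:M (- b) 0 1%:M.
have uV : V \in unitmx by rewrite unitmxE det_ublock !det1 mulr1 unitr1.
have UGV : U *m G *m V = block_mx (1%:M : 'M_1) 0 0 F2.
  rewrite UGE mulmx_block !mulmx1 !mulmx0 !mul0mx !mul1mx !addr0 addNr add0r //.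
apply: (monomial_smith_equiv uU uV); rewrite UGV.
have [_ rk2 M2d] := monomial_minors_equiv uU uV MG; rewrite UGV in rk2 M2d.
have MF2 : monomial_minors F2 r (fun i => D' i.+1).
  split=> //.
    by apply/eq_add_S; rewrite -[RHS]rk2 mrank_block_triangular // matrix_nonzero1.
  by move=> i le_i; apply: minor_ideal_diag1; apply: M2d.
have [Dconv2 [U2 [V2 [uU2 uV2 UV2]]]] := IHr F2 _ MF2 leN'.
split.
  case=> [|a] j le_a; first by rewrite D'1 mnm0E.
  exact: Dconv2.
exists (block_mx 1%:M 0 0 U2), (block_mx 1%:M 0 0 V2); split.
- by rewrite unitmxE det_ublock det1 mul1r.
- by rewrite unitmxE det_ublock det1 mul1r.
rewrite !mulmx_block !(mulmx0, mul0mx, mulmx1, mul1mx, addr0, add0r) UV2.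
apply/matrixP=> i j; rewrite [RHS]mxE.
case: (split_ordP i) => i' ->; case: (split_ordP j) => j' ->.
- rewrite block_mxEul !ord1 !mxE /= /quotient_exp D'1; case: MG => -> _ _.
  suff -> : (0 - 0)%MM = 0%MM :> 'X_{1..n} by rewrite (mono0 monoS).
  by apply/mnmP => k; rewrite mnmBE mnm0E.
- by rewrite block_mxEur (ord1 i') mxE /= ?add1n.
- by rewrite block_mxEdl (ord1 j') mxE /= ?add1n.
- by rewrite block_mxEdr mxE /= !add1n eqSS ltnS.
Qed.

Theorem monomial_smith_form l m (F : 'M[R]_(l, m)) r D :
  monomial_minors F r D -> monomial_smith F r D.
Proof.
suff all_below N : smith_below N by move=> MF; apply: all_below MF (ltnSn _).
elim: N => [|N IHN] {}l {}m {}F {}r {}D MF //; rewrite ltnS => leN.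
have [D0 rF Fd] := MF.
have [U [V [F0 [uU uV UFV]]]] := square_reduction Rs rF (Fd r (leqnn _)) (mono_neq0 monoS _).
have le_l : (r <= l)%N by rewrite -rF; apply: rank_leq_row.
have le_m : (r <= m)%N by rewrite -rF; apply: rank_leq_col.
apply: (monomial_smith_equiv uU uV).
have MG := monomial_minors_equiv uU uV MF.
have [l' lE] : exists l', l = (r + l')%N by exists (l - r)%N; rewrite subnKC.
have [m' mE] : exists m', m = (r + m')%N by exists (m - r)%N; rewrite subnKC.
subst l m; move: (U *m F *m V) UFV MG => G GE MG {F MF rF Fd U V uU uV}.
have F0E : F0 = pid_mx r *m G *m pid_mx r.
  have pidK s : (pid_mx r : 'M[R]_(r, r + s)) *m (pid_mx r : 'M_(r + s, r)) = 1%:M.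
    by rewrite mul_pid_mx minnn (minn_idPr (leq_addr _ _)) pid_mx_1.
  by rewrite GE mulmxA mulmxA pidK mul1mx -mulmxA pidK mulmx1.
have MF0 : monomial_minors F0 r D.
  have [_ rG Gd] := MG; split=> //; last first.
    by move=> i le_i; apply: minor_ideal_mul (Gd i le_i); [exact: F0E | exact: GE].
  apply/eqP; rewrite eqn_leq rank_leq_row /= -[X in (X <= _)%N]rG GE.
  exact: leq_trans (mrank_mul_le_l _ _) (mrank_mul_le_r _ _).
have [Dconv [U [V [uU uV UV]]]] := square_monomial_smith IHN MF0 leN.
split=> //; exists (block_mx U 0 0 1%:M), (block_mx V 0 0 1%:M); split.
- by rewrite unitmxE det_ublock det1 mulr1.
- by rewrite unitmxE det_ublock det1 mulr1.
have -> : G = block_mx F0 0 0 0.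
  have -> : G = col_mx 1%:M 0 *m F0 *m row_mx 1%:M 0.
    rewrite GE; congr (_ *m _ *m _); apply/matrixP=> i j; rewrite !mxE.
      case: (split_ordP i) => i' -> /=; rewrite ?col_mxEu ?col_mxEd !mxE /=.
        by rewrite andbT.
      by rewrite andbF.
    case: (split_ordP j) => j' -> /=; rewrite ?row_mxEl ?row_mxEr !mxE /=.
      by rewrite ltn_ord andbT.
    by case: eqP => //= ->; rewrite ltnNge leq_addr.
  by rewrite mul_col_mx mul1mx mul0mx mul_mx_row mulmx1 mulmx0 block_mxEh col_mx0.
rewrite !mulmx_block !(mulmx0, mul0mx, addr0) UV.
apply/matrixP=> i j; rewrite [RHS]mxE.
case: (split_ordP i) => i' ->; case: (split_ordP j) => j' ->.
- by rewrite block_mxEul mxE ltn_ord.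
- rewrite block_mxEur mxE /=; case: eqP => //= ij.
  by have := ltn_ord i'; rewrite ij ltnNge leq_addr.
- by rewrite block_mxEdl mxE andbF.
- by rewrite block_mxEdr mxE andbF.
Qed.

End MonomialSmith.

(** * Polynomial rings and Smith forms *)

Section Kill.
Variables (K : fieldType) (n : nat).
Notation R := {mpoly K[n]}.

Definition kill_image (j i : 'I_n) : R := if i == j then 0 else 'X_i.

Definition mpoly_kill (j : 'I_n) : {rmorphism R -> R} := mmap (@mpolyC n K) (kill_image j).

Lemma killC j c : mpoly_kill j c%:MP = c%:MP.
Proof. by rewrite /mpoly_kill /= mmapC. Qed.

Lemma killXU j i : mpoly_kill j 'X_i = kill_image j i.
Proof. by rewrite /mpoly_kill /= mmapX mmap1U. Qed.

Lemma killX j (m : 'X_{1..n}) : mpoly_kill j 'X_[m] = if m j == 0%N then 'X_[m] else 0.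
Proof.
rewrite /mpoly_kill /= mmapX /mmap1; case: eqP => [mj|/eqP mj].
  rewrite mpolyXE_id; apply: eq_bigr => i _; rewrite /kill_image.
  by case: eqP => // ->; rewrite mj !expr0.
by rewrite (bigD1 j) //= /kill_image eqxx expr0n (negPf mj) mul0r.
Qed.

Lemma mpoly_kill_split j p : exists q, p = mpoly_kill j p + 'X_j * q.
Proof.
elim/mpolyind: p => [|c m p _ _ [q pE]]; first by exists 0; rewrite rmorph0 mulr0 addr0.
have [r mE] : exists r, 'X_[m] = mpoly_kill j 'X_[m] + 'X_j * r :> R.
  rewrite killX; case: eqP => [_|/eqP mj]; first by exists 0; rewrite mulr0 addr0.
  by exists 'X_[m - U_(j)]; rewrite add0r -mpolyXD addmC submK // lep1mP.
exists (c%:MP * r + q); rewrite rmorphD -mul_mpolyC rmorphM killC.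
by rewrite {1}pE {1}mE !mulrDr addrACA mulrCA.
Qed.

Lemma mpoly_kill_comm i j p : mpoly_kill i (mpoly_kill j p) = mpoly_kill j (mpoly_kill i p).
Proof.
apply: (rmorph_mpoly_ext (f := mpoly_kill i \o mpoly_kill j) (g := mpoly_kill j \o mpoly_kill i)) => [a|k] /=.
  by rewrite !killC.
have kk a b : mpoly_kill a (kill_image b k) = if (k == a) || (k == b) then 0 else 'X_k.
  rewrite /kill_image; case: (k == b); first by rewrite rmorph0 orbT.
  by rewrite killXU orbF.
by rewrite !killXU !kk orbC.
Qed.

Lemma mpolyX_divides (u v : 'X_{1..n}) (q : R) : 'X_[v] = q * 'X_[u] -> (u <= v)%MM.
Proof.
move=> vE; have : v \in msupp ('X_[v] : R) by rewrite msuppX mem_head.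
rewrite vE (perm_mem (msuppMX _ _)) => /mapP [m _ ->].
by apply/mnm_lepP => i; rewrite mnmDE leq_addr.
Qed.

Lemma mpolyX_neq0 (u : 'X_{1..n}) : 'X_[u] != 0 :> R.
Proof. by rewrite -msupp_eq0 msuppX. Qed.

Lemma mpolyX_factor (D : 'X_{1..n}) (p q : R) : p * q = 'X_[D] ->
  exists u c c', p = c * 'X_[u] /\ c * c' = 1.
Proof.
have [N] := ubnP (mdeg D); elim: N D p q => // N IH D p q; rewrite ltnS => leN pq.
have [D0|D0] := eqVneq D 0%MM.
  by exists 0%MM, p, q; rewrite mpolyX0 mulr1 pq D0 mpolyX0.
have [j Dj] := mnm_neq0_var D0.
have leD : (U_(j) <= D)%MM by rewrite lep1mP.
have degD : (mdeg (D - U_(j))%MM < N)%N.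
  apply: leq_trans leN; have := congr1 mdeg (submK leD).
  by rewrite mdegD mdeg1 addn1 => <-.
have XD : 'X_[D] = 'X_j * 'X_[D - U_(j)] :> R.
  by rewrite -mpolyXD addmC submK.
have : mpoly_kill j p * mpoly_kill j q = 0 by rewrite -rmorphM pq killX (negPf Dj).
move/eqP; rewrite mulf_eq0 => /orP [/eqP kp|/eqP kq].
  have [p' pE] := mpoly_kill_split j p; rewrite kp add0r in pE.
  have [|u [c [c' [p'E cc']]]] := IH _ p' q degD.
    by apply: (mulfI (mpolyX_neq0 U_(j))); rewrite mulrA -pE pq.
  exists (U_(j) + u)%MM, c, c'; split=> //.
  by rewrite pE p'E mpolyXD mulrCA.
have [q' qE] := mpoly_kill_split j q; rewrite kq add0r in qE.
apply: (IH _ p q' degD); apply: (mulfI (mpolyX_neq0 U_(j))).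
by rewrite mulrCA -qE pq.
Qed.

Lemma mpoly_monomial_system : monomial_system (@mpolyX n K) mpoly_kill.
Proof.
split; [exact: mpolyX0 | exact: mpolyXD | exact: mpolyX_neq0 | exact: mpolyX_divides
  | exact: killX | exact: mpoly_kill_split | exact: mpoly_kill_comm].
Qed.

End Kill.


(** An isomorphism [f] carries the variables of [R] to coordinates of [R'], so
    that matrices over [R'] need not be moved to [R]. *)
Lemma monomial_system_iso (R R' : idomainType) n (mono : 'X_{1..n} -> R)
    (kill : 'I_n -> {rmorphism R -> R})
    (f : {rmorphism R -> R'}) (g : {rmorphism R' -> R}) :
  cancel f g -> cancel g f -> monomial_system mono kill ->
  monomial_system (f \o mono) (fun j => f \o (kill j \o g) : {rmorphism R' -> R'}).
Proof.
move=> fK gK [m0 mD mN mdvd km ks kc]; split=> /=.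
- by rewrite m0 rmorph1.
- by move=> u v; rewrite mD rmorphM.
- by move=> u; rewrite -(rmorph0 f) (can_eq fK).
- move=> u v q /(congr1 g); rewrite rmorphM !fK; exact: mdvd.
- by move=> j u; rewrite fK km; case: ifP => //; rewrite rmorph0.
- move=> j p; have [q qE] := ks j (g p); exists (f q).
  by rewrite -rmorphM -rmorphD -qE gK.
- by move=> i j p; rewrite !fK kc.
Qed.

Section SmithForms.
Variable R : idomainType.

Lemma ideal_gen_ideal (S : R -> Prop) : is_ideal (ideal_gen S).
Proof.
split.
- by exists [::]; rewrite big_nil.
- move=> _ _ [s [sS ->]] [t [tS ->]]; exists (s ++ t); rewrite big_cat; split=> //.
  by move=> x; rewrite mem_cat => /orP [/sS|/tS].
- move=> a _ [s [sS ->]]; exists [seq (a * x.1, x.2) | x <- s]; split.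
    by move=> _ /mapP [x xs ->]; apply: (sS x xs).
  by rewrite big_map mulr_sumr; apply: eq_bigr => x _; rewrite mulrA.
Qed.

Lemma ideal_gen_mem (S : R -> Prop) x : S x -> ideal_gen S x.
Proof.
move=> Sx; exists [:: (1, x)]; rewrite big_seq1 mul1r; split=> //.
by move=> y; rewrite inE => /eqP ->.
Qed.

Lemma ideal_gen_sub (S J : R -> Prop) : is_ideal J -> (forall x, S x -> J x) ->
  forall x, ideal_gen S x -> J x.
Proof.
move=> idJ SJ _ [s [sS ->]]; rewrite big_seq; apply: ideal_sum => // x xs.
by apply: idealMl => //; apply: SJ; apply: sS.
Qed.

Variables l m : nat.
Implicit Types F : 'M[R]_(l, m).

Lemma minors_in_is_minor F i (J : R -> Prop) : is_ideal J ->
  (forall p, is_minor F i p -> J p) -> minors_in J F i.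
Proof.
move=> idJ FJ; apply: minors_in_increasing => // f g fi gi.
by apply: FJ; exists f, g.
Qed.

Lemma minor_gcd_dvd F i d d' : is_minor_gcd F i d -> is_minor_gcd F i d' -> divides d d'.
Proof. by move=> [dF _] [_ d'F]; apply: d'F. Qed.

Lemma smith_form_leading_minor F (S : 'M[R]_(l, m)) (d h : nat -> R) i (le_l : (i <= l)%N) (le_m : (i <= m)%N) :
  S = \matrix_(x, y) (if ((x : nat) == y) && (x < mrank F)%N then h x else 0) ->
  d 0%N = 1 -> (forall k, (k < mrank F)%N -> d k.+1 = h k * d k) ->
  (i <= mrank F)%N -> \det (mxsub (widen_ord le_l) (widen_ord le_m) S) = d i.
Proof.
move=> -> d0 dS le_i; rewrite det_trig.
  have -> : \prod_(k < i) mxsub (widen_ord le_l) (widen_ord le_m)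
      (\matrix_(x, y) (if ((x : nat) == y) && (x < mrank F)%N then h x else 0)) k k =
      \prod_(k < i) h k.
    by apply: eq_bigr => k _; rewrite !mxE /= eqxx (leq_trans (ltn_ord k)).
  move: le_i; elim: i {le_l le_m} => [|i IHi] le_i; first by rewrite big_ord0 d0.
  by rewrite big_ord_recr /= IHi ?(ltnW le_i) // dS // mulrC.
by apply/is_trig_mxP => x y xy; rewrite !mxE /= ltn_eqF.
Qed.

(** The ideal generated by the [i]-minors of [F] contains the leading [i]-minor
    of the Smith form, which is [d i]; dividing by [d i] gives the claim. *)
Lemma smith_form_reduced_minors F : equivalent_to_smith_form F ->
  forall i, (1 <= i <= mrank F)%N -> whole_ring (reduced_minor_ideal F i).
Proof.
move=> [S [[d [h [d0 d_gcd dS SE]]] [U [V [uU uV UFV]]]]] i /andP [i0 le_i].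
have idr := ideal_gen_ideal (is_reduced_minor F i).
suff one : reduced_minor_ideal F i 1.
  by move=> p; rewrite -[p]mulr1; apply: (idealMl idr).
have le_l : (i <= l)%N by apply: leq_trans le_i (rank_leq_row _).
have le_m : (i <= m)%N by apply: leq_trans le_i (rank_leq_col _).
have gcd_i := d_gcd i; rewrite i0 le_i in gcd_i; have {}gcd_i := gcd_i isT.
have [d_dvd _] := gcd_i.
(* When [d i] is zero, so are all the [i]-minors, and any [q] is a quotient of
   one of them by [d i]. *)
have [di0|di0] := eqVneq (d i) 0.
  apply: ideal_gen_mem; exists (d i); split=> //.
  exists (widen_ord le_l), (widen_ord le_m); split=> //.
  have /d_dvd [q ->] : is_minor F i (\det (mxsub (widen_ord le_l) (widen_ord le_m) F)).
    by exists (widen_ord le_l), (widen_ord le_m); split.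
  by rewrite di0 !mulr0.
pose J y := exists2 z, ideal_gen (is_reduced_minor F i) z & y = z * d i.
have idJ : is_ideal J.
  split; first by exists 0; [exact: (ideal0 idr) | rewrite mul0r].
    by move=> _ _ [x Jx ->] [y Jy ->]; exists (x + y); [exact: (idealD idr) | rewrite mulrDl].
  by move=> a _ [x Jx ->]; exists (a * x); [exact: (idealMl idr) | rewrite mulrA].
have JF : minors_in J F i.
  apply: minors_in_is_minor => // p minp; have [q pE] := d_dvd p minp.
  exists q => //; apply: ideal_gen_mem; exists (d i); split=> //.
  by rewrite -pE.
have := minors_in_mul idJ U V JF; rewrite UFV => /(_ (widen_ord le_l) (widen_ord le_m)).
rewrite (smith_form_leading_minor le_l le_m SE d0 dS le_i) => -[z Jz].
by rewrite -[LHS]mul1r => /(mulIf di0) ->.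
Qed.

(** A combination of reduced minors equal to [1] becomes, multiplied by [d], a
    combination of minors equal to [d]. *)
Lemma reduced_minors_minor_ideal F i : whole_ring (reduced_minor_ideal F i) ->
  exists2 d, is_minor_gcd F i d & minor_ideal F i d.
Proof.
move=> all_red; have [s [sS one]] := all_red 1.
have [d d_gcd] : exists d, is_minor_gcd F i d.
  case: s sS one => [_ /eqP|x s sS _]; first by rewrite big_nil oner_eq0.
  by have [d [d_gcd _]] := sS x (mem_head _ _); exists d.
exists d => // J idJ; split=> [JF|Jd].
  rewrite -[d]mul1r; pose Jd y := J (y * d); rewrite -/(Jd 1).
  apply: (ideal_gen_sub (S := is_reduced_minor F i)) (all_red 1).
    split; first by rewrite /Jd mul0r; apply: ideal0.
      by move=> x y Jx Jy; rewrite /Jd mulrDl; apply: idealD.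
    by move=> a x Jx; rewrite /Jd -mulrA; apply: idealMl.
  move=> q [d' [d'_gcd [f [g [_ _ qd]]]]].
  have [c' dE'] := minor_gcd_dvd d'_gcd d_gcd.
  rewrite /Jd dE' mulrCA qd; apply: idealMl => //; exact: JF.
apply: minors_in_is_minor => // p minp; have [q ->] := d_gcd.1 p minp.
exact: idealMl.
Qed.

Lemma minor_ideal_gcd F i d : minor_ideal F i d -> is_minor_gcd F i d.
Proof.
move=> Fd; split=> [_ [f [g [_ _ ->]]]|e eF]; first exact: minor_ideal_minor.
have idJ := multiples_ideal e; apply/(Fd _ idJ).
exact: minors_in_is_minor.
Qed.

End SmithForms.

Lemma tame_bijective (K : fieldType) n (psi : {lrmorphism {mpoly K[n]} -> {mpoly K[n]}}) :
  is_tame psi -> bijective psi.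
Proof.
elim=> [? []|? []|phi psi' chi _ bphi _ bpsi chiE] //.
by apply: (eq_bij (bij_comp bphi bpsi)) => x; rewrite /= chiE.
Qed.

Lemma rmorph_inverse (R R' : pzRingType) (f : {rmorphism R -> R'}) : bijective f ->
  exists g : {rmorphism R' -> R}, cancel f g /\ cancel g f.
Proof.
move=> [g fK gK].
have gA : zmod_morphism g := can2_zmod_morphism fK gK.
have gM : monoid_morphism g := can2_monoid_morphism fK gK.
pose g1 := GRing.isZmodMorphism.Build R' R g gA.
pose g2 := GRing.isMonoidMorphism.Build R' R g gM.
pose g' : {rmorphism R' -> R} := HB.pack g g1 g2.
by exists g'.
Qed.

(** Each gcd of minors divides the next one, hence the last one, which is a
    monomial. *)
Lemma monomial_gcds (R : idomainType) n (mono : 'X_{1..n} -> R)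
    (kill : 'I_n -> {rmorphism R -> R}) l m (F : 'M[R]_(l, m)) (t : 'X_{1..n}) :
  monomial_system mono kill ->
  (forall u p q, p * q = mono u -> exists v c c', p = c * mono v /\ c * c' = 1) ->
  is_minor_gcd F (mrank F) (mono t) ->
  (forall i, (1 <= i <= mrank F)%N -> whole_ring (reduced_minor_ideal F i)) ->
  exists D, monomial_minors mono F (mrank F) D.
Proof.
move=> monoS mono_factor F_gcd all_red.
suff ex_D i : exists u, (i = 0%N -> u = 0%MM) /\
    ((i <= mrank F)%N -> minor_ideal F i (mono u)).
  have [D DP] := choice ex_D; exists D; split=> // [|i]; [exact: (DP 0%N).1 | exact: (DP i).2].
have [->|i0] := posnP i.
  by exists 0%MM; split=> // _; rewrite (mono0 monoS); apply: minor_ideal0.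
have [le_i|gt_i] := leqP i (mrank F); last by exists 0%MM; split=> // i00; rewrite i00 in i0.
have dvd_mono k j d : (j + k)%N = mrank F -> (0 < j)%N -> minor_ideal F j d ->
    exists q, mono t = q * d.
  elim: k j d => [|k IHk] j d jk j0 Fd.
    rewrite addn0 in jk; rewrite jk in Fd.
    exact: minor_gcd_dvd (minor_ideal_gcd Fd) F_gcd.
  have lt_j : (j < mrank F)%N by rewrite -jk addnS ltnS leq_addr.
  have [|e _ Fe] := reduced_minors_minor_ideal (all_red j.+1 _); first by [].
  have [q ->] : exists q, mono t = q * e by apply: IHk Fe; rewrite ?addSnnS.
  have [q' ->] := minor_ideal_dvd Fd Fe.
  by exists (q * q'); rewrite mulrA.
have [|d _ Fd] := reduced_minors_minor_ideal (all_red i _); first by rewrite i0.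
have [|q qE] := dvd_mono (mrank F - i)%N i d _ i0 Fd; first by rewrite subnKC.
have [|v [c [c' [dE cc']]]] := mono_factor t d q; first by rewrite qE mulrC.
exists v; split=> [i00|_]; first by rewrite i00 in i0.
by apply: minor_idealU cc' _; rewrite -dE.
Qed.

Lemma monomial_smith_is_smith (R : idomainType) n (mono : 'X_{1..n} -> R)
    (kill : 'I_n -> {rmorphism R -> R}) l m (F : 'M[R]_(l, m)) D :
  monomial_system mono kill -> monomial_minors mono F (mrank F) D ->
  monomial_smith mono F (mrank F) D -> equivalent_to_smith_form F.
Proof.
move=> monoS MF [_ [U [V [uU uV UFV]]]].
exists (diag_monomials mono l m (mrank F) (quotient_exp D)); split; last by exists U, V.
have [D0 _ Fd] := MF.
exists (mono \o D), (mono \o quotient_exp D); split=> //=.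
- by rewrite D0 (mono0 monoS).
- by move=> i /andP [_ le_i]; apply: minor_ideal_gcd; apply: Fd.
move=> k lt_k; rewrite -(monoD monoS) submK //.
by apply/mnm_lepP => j; apply: (monomial_minors_le monoS MF).
Qed.

Theorem corollary35 (K : fieldType) (charK0 : [pchar K] =i pred0)
    (n : nat) (n_ge2 : (2 <= n)%N)
    (psi : {lrmorphism {mpoly K[n]} -> {mpoly K[n]}}) (psi_tame : is_tame psi)
    (g : 'I_n -> {mpoly K[n]}) (psi_g : forall i : 'I_n, psi 'X_i = g i)
    (l m : nat) (F : 'M[{mpoly K[n]}]_(l, m))
    (gamma : nat) (F_rank : mrank F = gamma)
    (gamma_range : (1 <= gamma <= minn l m)%N)
    (t : 'I_n -> nat)
    (F_gcd : is_minor_gcd F gamma (\prod_(i < n) g i ^+ t i)) :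
  equivalent_to_smith_form F <->
  (forall i : nat, (1 <= i <= gamma)%N -> whole_ring (reduced_minor_ideal F i)).
Proof.
subst gamma; split; first exact: smith_form_reduced_minors.
move=> all_red.
have [tau [psiK tauK]] := rmorph_inverse (tame_bijective psi_tame).
have monoS := monomial_system_iso psiK tauK (mpoly_monomial_system K n).
have prod_mono : \prod_(i < n) g i ^+ t i = psi 'X_[[multinom t i | i < n]].
  rewrite mpolyXE_id rmorph_prod; apply: eq_bigr => i _.
  by rewrite rmorphXn /= psi_g mnmE.
rewrite prod_mono in F_gcd.
have mono_factor u p q : p * q = psi 'X_[u] ->
    exists v c c', p = c * psi 'X_[v] /\ c * c' = 1.
  move/(congr1 tau); rewrite rmorphM psiK => /mpolyX_factor [v [c [c' [pE cc']]]].
  exists v, (psi c), (psi c'); rewrite -!rmorphM -pE tauK; split=> //.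
  by rewrite cc' rmorph1.
have [D MF] := monomial_gcds monoS mono_factor F_gcd all_red.
apply: (monomial_smith_is_smith monoS MF).
apply: (monomial_smith_form monoS) MF.
exact: (mpoly_splitting n charK0).2.
Qed.
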